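(* Let $H\in C(\mathbb R^n\times\mathbb R^n)$, $H=H(p,y)$, be such that: for each $y\in\mathbb R^n$, $p\mapsto H(p,y)$ is convex; $\lim_{|p|\to\infty}\inf_{y\in\mathbb R^n}H(p,y)=+\infty$; and, for each $R>0$, $H$ is uniformly continuous and bounded on $B_R\times\mathbb R^n$. Let $U\subseteq\mathbb R^n$ be a bounded open set. If a bounded function $u\in\mathrm{USC}(U)$ is an absolute subminimizer for $H$ in $U$, then $u$ satisfies comparisons with distance functions from above with respect to $H$ in $U$.
   Context: Notation: $B_R=\{x\in\mathbb R^n:|x|<R\}$. $V\ll U$ means $V\subseteq\mathbb R^n$ is open and $\overline V\subseteq U$. $\mathrm{USC}(U)$ denotes the upper semicontinuous functions $U\to\mathbb R$. $C^{0,1}$ and $C^{0,1}_{\mathrm{loc}}$ denote Lipschitz and locally Lipschitz functions. Equations are understood in the viscosity sense. Absolute subminimizer: $u\in C^{0,1}_{\mathrm{loc}}(U)$ is an absolute subminimizer for $H$ in $U$ if, for every $V\ll U$ and every $v\in C^{0,1}(V)$ with $v\le u$ in $V$ and $v=u$ on $\partial V$, $\operatorname{ess\,sup}_{x\in V}H(Du(x),x)\le\operatorname{ess\,sup}_{x\in V}H(Dv(x),x)$. Effective nonlinearity: $\overline H(p)$ is the infimum of all $\mu\in\mathbb R$ for which there exists $w\in C^{0,1}(\mathbb R^n)$ with $\lim_{|y|\to\infty}|y|^{-1}w(y)=0$ satisfying $H(p+Dw,y)\le\mu$ in $\mathbb R^n$ in the viscosity sense (equivalently, almost everywhere). The function $\overline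 H$ is convex, continuous and coercive. Distance functions: for $p\in\mathbb R^n$, $\mu>\overline H(p)$ and $x_0\in\mathbb R^n$, let $d_{\mu,x_0,p}$ be the unique continuous function on $\mathbb R^n$ which is a viscosity solution of $H(p+Du,y)=\mu$ in $\mathbb R^n\setminus\{x_0\}$ and satisfies $\liminf_{|y|\to\infty}|y|^{-1}d_{\mu,x_0,p}(y)>0$ and $d_{\mu,x_0,p}(x_0)=0$. Fix $p_*\in\mathbb R^n$ with $\overline H(p_* )=\min_{\mathbb R^n}\overline H$ and, for $\mu>\min\overline H$, set $d_{\mu,x_0}(y):=d_{\mu,x_0,p_*}(y)+p_*\cdot(y-x_0)$ (this does not depend on the choice of $p_*$). In particular $H(Dd_{\mu,x_0},y)=\mu$ in $\mathbb R^n\setminus\{x_0\}$. Comparisons: a bounded function $u:U\to\mathbb R$ satisfies comparisons with distance functions from above (with respect to $H$ in $U$) if $$\max_{x\in\overline V}\big(u(x)-d_{\mu,x_0}(x)\big)=\max_{x\in\partial V}\big(u(x)-d_{\mu,x_0}(x)\big)$$ whenever $\mu>\min\overline H$, $V\ll U$ and $x_0\in\mathbb R^n\setminus V$. *)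

(* Defs.v *)
From HB Require Import structures.
From mathcomp Require Import all_boot all_order all_algebra.
From mathcomp Require Import all_classical all_reals all_analysis.
Set Implicit Arguments.
Unset Strict Implicit.
Unset Printing Implicit Defensive.
Import Order.TTheory GRing.Theory Num.Theory.
Import numFieldNormedType.Exports.
Local Open Scope classical_set_scope.
Local Open Scope ring_scope.

Section Euclidean.
Context {R : realType} {n : nat}.
Implicit Types (x y : 'rV[R]_n) (A U V : set 'rV[R]_n).

Definition dot x y : R := \sum_(i < n) x 0 i * y 0 i.

(* The library norm on 'rV[R]_n is the sup norm; it induces the same topology,
   bounded sets and Lipschitz functions as the Euclidean one. *)
Definition enorm x : R := Num.sqrt (dot x x).

Definition infty_nbhs : set_system 'rV[R]_n :=
  [set A | exists M : R, forall y, M < enorm y -> A y].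

Global Instance infty_nbhs_filter : Filter infty_nbhs.
Proof.
split.
- by exists 0.
- move=> P Q [M MP] [N NQ]; exists (Num.max M N) => y.
  by rewrite gt_max => /andP[/MP Py /NQ Qy].
- by move=> P Q PQ [M MP]; exists M => y /MP /PQ.
Qed.

Definition box (a b : 'rV[R]_n) : set 'rV[R]_n :=
  [set x | forall i, a 0 i <= x 0 i <= b 0 i].

Definition lebesgue_outer A : \bar R :=
  ereal_inf [set s | exists a b : nat -> 'rV[R]_n,
    [/\ forall k i, a k 0 i <= b k 0 i,
        A `<=` \bigcup_k box (a k) (b k) &
        s = (\sum_(0 <= k <oo) (\prod_(i < n) (b k 0 i - a k 0 i))%:E)%E]].

Definition ess_sup_on V (f : 'rV[R]_n -> \bar R) : \bar R :=
  ereal_inf [set M | lebesgue_outer [set x | V x /\ ~ (f x <= M)%E] = 0%E].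

(* A locally Lipschitz function is differentiable almost everywhere, so that
   its values of [grad] at the remaining points do not affect [ess_sup_on]. *)
Definition grad (f : 'rV[R]_n -> R) x : 'rV[R]_n :=
  \row_(i < n) 'D_(delta_mx 0 i) f x.

Definition C1_on U (f : 'rV[R]_n -> R) : Prop :=
  (forall x, U x -> differentiable f x) /\
  (forall x, U x -> {for x, continuous (grad f)}).

Definition well_inside V U : Prop := open V /\ closure V `<=` U.

Definition boundary A : set 'rV[R]_n := closure A `\` interior A.

Definition locally_lipschitz U (f : 'rV[R]_n -> R) : Prop :=
  forall x, U x -> exists2 A, nbhs x A & [lipschitz f y | y in A].

Definition usc_on U (f : 'rV[R]_n -> R) : Prop :=
  forall x, U x -> forall a, f x < a -> \forall y \near within U (nbhs x), f y < a.

Definition is_max_on A (f : 'rV[R]_n -> R) (m : R) : Prop :=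
  (exists2 x, A x & f x = m) /\ (forall x, A x -> f x <= m).

Definition visc_subsolution U (F : 'rV[R]_n -> 'rV[R]_n -> R) (mu : R)
    (u : 'rV[R]_n -> R) : Prop :=
  forall phi x, C1_on U phi -> U x ->
    (\forall y \near x, u y - phi y <= u x - phi x) -> F (grad phi x) x <= mu.

Definition visc_supersolution U (F : 'rV[R]_n -> 'rV[R]_n -> R) (mu : R)
    (u : 'rV[R]_n -> R) : Prop :=
  forall phi x, C1_on U phi -> U x ->
    (\forall y \near x, u x - phi x <= u y - phi y) -> mu <= F (grad phi x) x.

Definition visc_solution U F mu u : Prop :=
  visc_subsolution U F mu u /\ visc_supersolution U F mu u.

End Euclidean.

Section Hamiltonian.
Context {R : realType} {n : nat}.
Variable H : 'rV[R]_n -> 'rV[R]_n -> R.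

Definition shiftH (p : 'rV[R]_n) : 'rV[R]_n -> 'rV[R]_n -> R :=
  fun q y => H (p + q) y.

(* [v] in C^{0,1}(V) is represented by its unique Lipschitz extension to the
   closure of [V], which gives a meaning to its boundary values. *)
Definition absolute_subminimizer (U : set 'rV[R]_n) (u : 'rV[R]_n -> R) : Prop :=
  locally_lipschitz U u /\
  forall (V : set 'rV[R]_n) (v : 'rV[R]_n -> R),
    well_inside V U ->
    [lipschitz v x | x in closure V] ->
    (forall x, V x -> v x <= u x) ->
    (forall x, boundary V x -> v x = u x) ->
    (ess_sup_on V (fun x => (H (grad u x) x)%:E)
       <= ess_sup_on V (fun x => (H (grad v x) x)%:E))%E.

Definition Hbar (p : 'rV[R]_n) : R :=
  inf [set mu : R | exists w : 'rV[R]_n -> R,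
    [/\ [lipschitz w y | y in setT],
        (enorm y)^-1 * w y @[y --> infty_nbhs] --> (0 : R) &
        visc_subsolution setT (shiftH p) mu w]].

(* [d] is the function d_{mu,x0,p}; it is meant to be used for Hbar p < mu. *)
Definition is_distance (p : 'rV[R]_n) (mu : R) (x0 : 'rV[R]_n)
    (d : 'rV[R]_n -> R) : Prop :=
  [/\ continuous d,
      visc_solution (~` [set x0]) (shiftH p) mu d,
      (0 < limf_einf (fun y => ((enorm y)^-1 * d y)%:E) infty_nbhs)%E &
      d x0 = 0].

(* d_{mu,x0}(y) is d y + ps . (y - x0), for a minimizer [ps] of Hbar and the
   function [d] characterized by [is_distance]; it depends on neither choice.
   The empty set is excluded because it carries no maximum. *)
Definition comparisons_from_above (U : set 'rV[R]_n) (u : 'rV[R]_n -> R) : Prop :=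
  forall (ps : 'rV[R]_n) (mu : R) (V : set 'rV[R]_n) (x0 : 'rV[R]_n)
      (d : 'rV[R]_n -> R),
    (forall p, Hbar ps <= Hbar p) -> Hbar ps < mu ->
    well_inside V U -> V !=set0 -> ~ V x0 ->
    is_distance ps mu x0 d ->
    let f x := u x - (d x + dot ps (x - x0)) in
    exists m : R, is_max_on (closure V) f m /\ is_max_on (boundary V) f m.

End Hamiltonian.

(* Main.v *)
(* Suppose that u - D, where D is the distance function, is larger somewhere in
   V than everywhere on the boundary of V. Near its high superlevel sets u is
   compared with a smooth approximation of D plus a constant, which is admissible
   in the definition of an absolute subminimizer: thus H(Du, x) <= mu + o(1) almost
   everywhere there. By convexity this survives mollification, and a convex
   combination of the mollification of u with that of a strict subsolution w
   (which exists as Hbar ps < mu) is a smooth function th, as close to u as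
   desired, with H(D th, x) < mu. Then th - D has an interior maximum, at which th
   contradicts the supersolution property of D.

   Mollified subsolutions are estimated through one-sided increments: for a
   subsolution D of H <= mu whose sublevel sets {H(., x) <= mu} lie in the half
   space {e . p <= a}, one has D(y + T e) - D(y) <= a T. Integrating this against
   the mollifier bounds e . D(mollified D) by a, and the sublevel set is the
   intersection of such half spaces. *)
Require Import Defs.
From HB Require Import structures.
From mathcomp Require Import all_boot all_order all_algebra.
From mathcomp Require Import all_classical all_reals all_analysis.
From mathcomp Require Import measurable_realfun ring lra.
Set Implicit Arguments.
Unset Strict Implicit.
Unset Printing Implicit Defensive.
Import Order.TTheory GRing.Theory Num.Theory.
Import numFieldNormedType.Exports.
Local Open Scope classical_set_scope.
Local Open Scope ring_scope.

(** * Directional derivatives of Lipschitz functions *)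

(** Two kinds of information are mollified. [D] and [w] are viscosity subsolutions, so their
    increments are bounded pointwise by means of test functions. About [u] only an essential
    supremum is known: there a derivative has to be exchanged with an integral, and Lebesgue measure
    on R^n, almost everywhere derivability and dominated convergence serve this purpose. As [grad]
    consists of partial derivatives, derivability is established one direction at a time. Both kinds
    end in the same place: a half space chosen for the values of H at one point, which contains the
    slightly lower sublevel sets at all nearby points because H is uniformly continuous on bounded
    sets of gradients.

    The supersolution property of [D] is tested with C^1 functions, which is why [u] is mollified at
    all. Mollification and the competitor cost errors in the level [mu]; the strict subsolution
    absorbs them, so its weight is fixed before the errors are. *)

Lemma stieltjes_ocitv (R : realType) (F : cumulative R R) (a b : R) : a <= b ->
  lebesgue_stieltjes_measure F `]a, b]%classic = (F b - F a)%:E.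
Proof.
move=> ab; rewrite /lebesgue_stieltjes_measure /measure_extension.
by rewrite measurable_mu_extE/= ?wlength_itv_bnd//; exact: is_ocitv.
Qed.

(** The measures of [F] and [G] add up to a measure that agrees with Lebesgue measure on half-open
    intervals, hence on all measurable sets. *)
Lemma stieltjes_le_lebesgue (R : realType) (F G : cumulative R R) :
  (forall x, F x + G x = x) ->
  forall A, measurable A ->
  (lebesgue_stieltjes_measure F A <= lebesgue_measure A)%E.
Proof.
move=> FG A mA.
pose m := measure_add (lebesgue_stieltjes_measure F) (lebesgue_stieltjes_measure G).
have mE X : m X = (lebesgue_stieltjes_measure F X + lebesgue_stieltjes_measure G X)%E.
  exact: measure_addE.
rewrite (@lebesgue_measure_unique R m _ A mA); last first.
  move=> X /ocitvP[->|[[a b] /= ab ->]]; first by rewrite !measure0.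
  rewrite [RHS]mE !stieltjes_ocitv ?ltW//.
  rewrite lebesgue_measure_itv/= lte_fin ab -EFinD; transitivity ((b - a)%:E) => //; congr EFin.
  by rewrite -{1}(FG b) -{1}(FG a); ring.
by rewrite [leRHS]mE leeDl.
Qed.

(** Radon-Nikodym, applied to the restriction of the Stieltjes measure to []a, b]], which makes it
    finite; domination by Lebesgue measure gives absolute continuity. *)
Lemma stieltjes_density (R : realType) (F G : cumulative R R) (a b : R) :
  a <= b -> (forall x, F x + G x = x) ->
  exists2 g : R -> R, lebesgue_measure.-integrable [set: R] (EFin \o g) &
    forall y, a <= y <= b -> F y - F a = \int[lebesgue_measure]_(t in `]a, y]) g t.
Proof.
move=> ab FG.
have mD : measurable (`]a, b]%classic : set R) by [].
pose nu0 := mrestr (lebesgue_stieltjes_measure F) mD.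
have nu0fin : fin_num_fun nu0.
  move=> A mA; rewrite ge0_fin_numE ?measure_ge0//.
  rewrite (@le_lt_trans _ _ (lebesgue_stieltjes_measure F `]a, b]%classic))//.
    by apply: le_measure; rewrite ?inE//=; exact: measurableI.
  by rewrite stieltjes_ocitv ?ltry.
pose nu : {finite_measure set _ -> \bar R} :=
  HB.pack_for (FiniteMeasure.type (measurableTypeR R) R) nu0
  (Measure_isFinite.Build _ _ _ nu0 nu0fin).
have numu : charge_of_finite_measure nu `<< (@lebesgue_measure R).
  apply/null_content_dominatesP => A mA A0; apply/eqP.
  rewrite eq_le measure_ge0 andbT -[leRHS]A0.
  apply: le_trans (stieltjes_le_lebesgue FG mA).
  by apply: le_measure; rewrite ?inE//=; exact: measurableI.
pose g := fun x => fine (Radon_Nikodym (charge_of_finite_measure nu) (@lebesgue_measure R) x).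
have gE : EFin \o g = Radon_Nikodym (charge_of_finite_measure nu) (@lebesgue_measure R).
  by apply/funext => x /=; rewrite fineK//; exact: (Radon_Nikodym_fin_num x numu).
exists g; first by rewrite gE; exact: (Radon_Nikodym_integrable numu).
move=> y /andP[ay yb].
rewrite /Rintegral.
rewrite -/(EFin \o g) gE -(Radon_Nikodym_integral numu)//.
rewrite /charge_of_finite_measure /= /nu0 /mrestr.
rewrite (_ : _ `&` _ = `]a, y]%classic) ?stieltjes_ocitv//.
apply/seteqP; split => [x [] //|x /= xay]; split => //.
by move: xay; rewrite !in_itv/= => /andP[-> /le_trans ->].
Qed.

Definition lip (R : realType) (V : normedModType R) (L : R) (f : V -> R) :=
  forall x y, `|f x - f y| <= L * `|x - y|.

(** In the zero space [L] may be negative; this provides a constant by which one can divide. *)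
Lemma lip_gt0 (R : realType) (V : normedModType R) (L : R) (f : V -> R) :
  lip L f -> lip (`|L| + 1) f.
Proof.
move=> fL x y; apply: (le_trans (fL x y)).
by rewrite ler_wpM2r// (le_trans (ler_norm _))// lerDl.
Qed.

Lemma lip_continuous (R : realType) (V : normedModType R) (L : R) (f : V -> R) :
  lip L f -> continuous f.
Proof.
move=> /lip_gt0 fL x; apply/cvgrPdist_lt => e e0.
have L1 : 0 < `|L| + 1 by rewrite ltr_wpDl.
apply/nbhs_normP; exists (e / (`|L| + 1)) => /=; first exact: divr_gt0.
move=> y /= xy; apply: (le_lt_trans (fL _ _)).
by rewrite mulrC -ltr_pdivlMr.
Qed.

Lemma lipschitz_derivable_ae (R : realType) (f : R -> R) (L : R) :
  lip L f ->
  {ae lebesgue_measure, forall t, t \in `]0%R, 1%R[ -> derivable f t 1}.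
Proof.
move=> fL0; pose M := `|L| + 1.
have M0 : 0 < M by rewrite ltr_wpDl.
have fL : lip M f by exact: lip_gt0.
have fc := lip_continuous fL.
(* [F0] and [G0] are nondecreasing and add up to the identity, so that their
   Stieltjes measures are dominated by Lebesgue measure and have densities, to
   which Lebesgue's differentiation theorem applies. *)
pose F0 x := (f x / M + x) / 2.
pose G0 x := (x - f x / M) / 2.
have key x y : x <= y -> `|f x / M - f y / M| <= y - x.
  move=> xy; rewrite -mulrBl normrM [X in _ * X]gtr0_norm ?invr_gt0//.
  by rewrite ler_pdivrMr// mulrC (le_trans (fL _ _))// distrC ger0_norm// subr_ge0.
have ndF : nondecreasing F0.
  move=> x y xy; have := key _ _ xy; rewrite /F0 ler_norml => /andP[? ?]; lra.
have ndG : nondecreasing G0.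
  move=> x y xy; have := key _ _ xy; rewrite /G0 ler_norml => /andP[? ?]; lra.
have cF : continuous F0.
  move=> x; apply: cvgM; last exact: cvg_cst.
  by apply: cvgD; [apply: cvgM; [exact: fc|exact: cvg_cst]|exact: cvg_id].
have cG : continuous G0.
  move=> x; apply: cvgM; last exact: cvg_cst.
  by apply: cvgB; [exact: cvg_id|apply: cvgM; [exact: fc|exact: cvg_cst]].
pose F : cumulative R R := HB.pack F0
  (isCumulative.Build R _ R F0 ndF (right_continuousW cF)).
pose G : cumulative R R := HB.pack G0
  (isCumulative.Build R _ R G0 ndG (right_continuousW cG)).
have FG x : F x + G x = x by rewrite /F /G /= /F0 /G0; lra.
have [g gi gE] := stieltjes_density (ler01 : 0 <= 1 :> R) FG.
have gint y : lebesgue_measure.-integrable [set` Interval (BRight (0:R)) (BRight y)] (EFin \o g).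
  exact: integrableS gi.
have gloc : locally_integrable setT g := (open_integrable_locally openT gi).
have := FTC1 gint gloc.
apply: filterS; first exact: (ae_filter_ringOfSetsType lebesgue_measure).
move=> t Ht; rewrite in_itv/= => /andP[t0 t1].
have [| dF _] := Ht; first exact: t0.
(* The definition of [F0] solved for [f], with [F] written as the integral of its density. *)
pose h y := M * (2 * (\int[lebesgue_measure]_(u in `]0, y]) g u + F 0) - y).
apply: (@near_eq_derivable _ _ _ h); last first.
  apply: derivableM; first exact: derivable_cst.
  apply: derivableB; last exact: derivable_id.
  apply: derivableM; first exact: derivable_cst.
  by apply: derivableD; [exact: dF|exact: derivable_cst].
near=> y; rewrite /h -gE.
  by rewrite /F/= /F0; field; rewrite gt_eqF.
by apply/andP; split; apply: ltW; near: y; [exact: lt_nbhsr|exact: lt_nbhsl].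
Unshelve. all: by end_near. Qed.

(* Lebesgue measure on R^n, carried by an iterated product [em_T] whose points
   are read as vectors by [em_X]; [em_shift] lifts the translations of R^n. *)
Record euclid_measure (R : realType) (n : nat) := EuclidMeasure {
  em_disp : measure_display;
  em_T : measurableType em_disp;
  em_mu : {sigma_finite_measure set em_T -> \bar R};
  em_X : em_T -> 'rV[R]_n;
  em_shift : 'rV[R]_n -> em_T -> em_T;
  em_meas : forall i, measurable_fun setT (fun w => em_X w 0 i);
  em_box : forall a b : 'rV[R]_n, (forall i, a 0 i <= b 0 i) ->
    em_mu (em_X @^-1` box a b) = (\prod_(i < n) (b 0 i - a 0 i))%:E;
  em_shiftE : forall h w, em_X (em_shift h w) = em_X w + h;
  em_shift_meas : forall h, measurable_fun setT
    (fun z : measurableTypeR R * em_T => em_shift (z.1 *: h) z.2);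
  em_shift_mu : forall h A, measurable A ->
    em_mu (em_shift h @^-1` A) = em_mu A }.

Lemma pushforward_measure (R : realType) (d d' : measure_display)
    (T : measurableType d) (T' : measurableType d')
    (mu : {measure set T -> \bar R}) (f : T -> T') : measurable_fun setT f ->
  exists m : {measure set T' -> \bar R}, forall A, m A = mu (f @^-1` A).
Proof.
move=> mf; exists
  (measure_function_pushforward__canonical__measure_function_Measure mu mf).
by [].
Qed.

Lemma lebesgue_measure_shift (R : realType) (t : R) (A : set (measurableTypeR R)) :
  measurable A -> lebesgue_measure ((fun x => x + t) @^-1` A) = lebesgue_measure A.
Proof.
move=> mA.
have mf : measurable_fun [set: measurableTypeR R] (fun x : measurableTypeR R => x + t : measurableTypeR R).
  by apply: measurable_funD.
have [m mE] := pushforward_measure (@lebesgue_measure R) mf.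
rewrite -mE (@lebesgue_measure_unique R m)//.
move=> X /ocitvP[->|[[a b] /= ab ->]]; first by rewrite !measure0.
rewrite mE lebesgue_measure_itv/= lte_fin ab.
rewrite (_ : _ @^-1` _ = `](a - t), (b - t)]%classic).
  rewrite lebesgue_measure_itv/= lte_fin ltrD2r ab -!EFinB; congr EFin; ring.
by apply/seteqP; split=> x /=; rewrite !in_itv/= ltrBlDr lerBrDr.
Qed.

(** Makes the product available as a factor of the next product. The exhaustions of the two factors
    are nondecreasing, so that the products of [F k] and [G k] with equal indices already cover the
    space. *)
Lemma product_sigma_finite (R : realType) (d d' : measure_display)
    (T : measurableType d) (T' : measurableType d')
    (m1 : {sigma_finite_measure set T -> \bar R})
    (m2 : {sigma_finite_measure set T' -> \bar R}) :
  exists m : {sigma_finite_measure set (T * T')%type -> \bar R},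
    forall A, m A = (m1 \x m2)%E A.
Proof.
have sf : sigma_finite setT (m1 \x m2)%E.
  have /sigma_finiteP[F [UF ndF Foo]] := sigma_finiteT m1.
  have /sigma_finiteP[G [UG ndG Goo]] := sigma_finiteT m2.
  exists (fun k => F k `*` G k) => [|k].
    apply/esym; rewrite -subTset => -[x y] _.
    have [[i _ Fx] [j _ Gy]] : (\bigcup_k F k) x /\ (\bigcup_k G k) y.
      by rewrite -UF -UG.
    exists (maxn i j) => //; split.
      exact: subsetPset (ndF _ _ (leq_maxl i j)) _ Fx.
    exact: subsetPset (ndG _ _ (leq_maxr i j)) _ Gy.
  have [[mF Fk] [mG Gk]] := (Foo k, Goo k).
  split; first exact: measurableX.
  by rewrite product_measure1E// lte_mul_pinfty// ge0_fin_numE.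
by exists (HB.pack_for (SigmaFiniteMeasure.type (T * T')%type R) (m1 \x m2)%E
  (Measure_isSigmaFinite.Build _ _ _ (m1 \x m2)%E sf)).
Qed.

Lemma measurable_box (R : realType) (n : nat) (d : measure_display)
    (T : measurableType d) (X : T -> 'rV[R]_n) (a b : 'rV[R]_n) :
  (forall i, measurable_fun setT (fun w => X w 0 i)) ->
  measurable (X @^-1` box a b).
Proof.
move=> mX; rewrite (_ : _ @^-1` _ =
    \bigcap_(i in [set: 'I_n]) ((fun w => X w 0 i) @^-1` `[a 0 i, b 0 i])).
  apply: fin_bigcap_measurable => [|i _]; first exact: finite_finset.
  by rewrite -[X in measurable X]setTI; exact: mX.
apply/seteqP; split => w /= Xw i; first by move=> _; rewrite /= in_itv; exact: Xw.
by have := Xw i Logic.I; rewrite /= in_itv.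
Qed.

Lemma lebesgue_measure_cc (R : realType) (a b : R) : a <= b ->
  lebesgue_measure `[a, b]%classic = (b - a)%:E.
Proof.
rewrite lebesgue_measure_itv/= lte_fin le_eqVlt => /predU1P[->|->//].
by rewrite ltxx subrr.
Qed.

(** Induction on the dimension: a Dirac mass, which gives the empty product its value 1, and then a
    product with the line for each new first coordinate. *)
Lemma euclid_measure_exists (R : realType) (n : nat) :
  inhabited (euclid_measure R n).
Proof.
elim: n => [|n [[d T mu X sh mX muX shE msh mush]]].
  pose mu : {sigma_finite_measure set unit -> \bar R} := dirac tt.
  constructor; exists _ unit mu (fun=> 0) (fun=> id).
  - by case.
  - move=> a b _; rewrite big_ord0 /mu/= diracE mem_set//.
    by move=> [].
  - by move=> h w; apply/rowP; case.
  - by move=> h /=; exact: measurable_snd.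
  - by [].
have [mu' mu'E] := product_sigma_finite (@lebesgue_measure R) mu.
pose X' (w : measurableTypeR R * T) : 'rV[R]_(1 + n) := row_mx (w.1)%:M (X w.2).
pose sh' (h : 'rV[R]_(1 + n)) (w : measurableTypeR R * T) : measurableTypeR R * T := (w.1 + lsubmx h 0 0, sh (rsubmx h) w.2).
have msh0 h : measurable_fun setT (sh h).
  have := measurableT_comp (msh h) (pair1_measurable (1 : measurableTypeR R)).
  by apply: eq_measurable_fun => x _ /=; rewrite scale1r.
have msh'0 h : measurable_fun setT (sh' h).
  apply: measurable_fun_pair.
    by apply: measurable_funD => //; exact: measurable_fst.
  exact: measurableT_comp (msh0 _) measurable_snd.
constructor; exists _ (measurableTypeR R * T)%type mu' X' sh'.
- move=> i; rewrite /X'.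
  have [j ->|j ->] := split_ordP i.
    under eq_fun do rewrite row_mxEl mxE (ord1 j) eqxx mulr1n.
    exact: measurable_fst.
  under eq_fun do rewrite row_mxEr.
  exact: measurableT_comp (mX j) measurable_snd.
- move=> a b ab.
  have boxE : X' @^-1` box a b = `[a 0 (lshift n 0), b 0 (lshift n 0)]%classic `*`
      (X @^-1` box (rsubmx (a : 'rV_(1 + n))) (rsubmx (b : 'rV_(1 + n)))).
    apply/seteqP; split => -[t w]; rewrite /X' /box /=.
      move=> H; split; first by have := H (lshift n 0); rewrite row_mxEl mxE eqxx mulr1n in_itv.
      by move=> i; have := H (rshift 1 i); rewrite row_mxEr !mxE.
    move=> [Ht Hw] i; have [j ->|j ->] := split_ordP i.
      by move: Ht; rewrite row_mxEl (ord1 j) mxE eqxx mulr1n in_itv.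
    by have := Hw j; rewrite row_mxEr !mxE.
  have mbox : measurable (X @^-1` box (rsubmx (a : 'rV_(1 + n))) (rsubmx (b : 'rV_(1 + n)))).
    exact: measurable_box.
  rewrite mu'E boxE product_measure1E// muX; last by move=> i; rewrite !mxE.
  rewrite [X in (X * _)%E](lebesgue_measure_cc (ab _)) -EFinM; congr EFin.
  rewrite [in RHS](@big_split_ord _ _ _ 1 n)/= big_ord1; congr (_ * _).
  by apply: eq_bigr => i _; rewrite !mxE.
- move=> h w; rewrite /X' /sh' /= shE -{3}(hsubmxK h) add_row_mx; congr row_mx.
  by apply/rowP => j; rewrite !mxE ord1 eqxx !mulr1n.
- move=> h; apply: measurable_fun_pair => /=.
    under eq_fun do rewrite !mxE.
    apply: measurable_funD; first exact: measurableT_comp measurable_fst measurable_snd.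
    by apply: measurable_funM => //; exact: measurable_fst.
  have mg : measurable_fun setT
      (fun z : measurableTypeR R * (measurableTypeR R * T) => (z.1, z.2.2)).
    apply: measurable_fun_pair; first exact: measurable_fst.
    exact: measurableT_comp measurable_snd measurable_snd.
  have := measurableT_comp (msh (rsubmx (h : 'rV_(1 + n)))) mg.
  by apply: eq_measurable_fun => z _ /=; rewrite linearZ.
- move=> h A mA.
  have [m mE] := pushforward_measure mu' (msh'0 h).
  (* Uniqueness of product measures reduces invariance under translation to rectangles, where it
     holds factor by factor. *)
  rewrite -mE; have := mu'E A => ->; apply/esym/product_measure_unique => //.
  move=> B C mB mC; rewrite mE; apply: (eq_trans (mu'E _)).
  rewrite (_ : _ @^-1` _ = ((fun x => x + lsubmx (h : 'rV_(1 + n)) 0 0) @^-1` B) `*`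
    (sh (rsubmx (h : 'rV_(1 + n))) @^-1` C))//.
  rewrite product_measure1E//.
  + by rewrite [X in (X * _)%E]lebesgue_measure_shift// mush.
  + rewrite -[X in measurable X]setTI.
    have : measurable_fun [set: measurableTypeR R] (+%R^~ (lsubmx (h : 'rV_(1 + n)) 0 0) : _ -> measurableTypeR R).
      by apply: measurable_funD.
    exact.
  + by rewrite -[X in measurable X]setTI; exact: msh0.
Qed.

(** * Dot product, sup norm and Euclidean norm *)

Section RowVectors.
Context {R : realType} {n : nat}.
Implicit Types (x y z h : 'rV[R]_n) (r : R).

Lemma coord_le_norm x i : `|x 0 i| <= `|x|.
Proof.
rewrite [leRHS]/Num.Def.normr/= mx_normrE.
exact: (le_bigmax _ (fun ij => `|x ij.1 ij.2|) (0, i)).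
Qed.

Lemma norm_leP x r : 0 <= r -> (forall i, `|x 0 i| <= r) -> `|x| <= r.
Proof.
move=> r0 xr; rewrite [leLHS]/Num.Def.normr/= mx_normrE.
by apply: bigmax_le => // -[i j] _ /=; rewrite ord1.
Qed.

Lemma dotC x y : dot x y = dot y x.
Proof. by apply: eq_bigr => i _; rewrite mulrC. Qed.

Lemma dotDl x y z : dot (x + y) z = dot x z + dot y z.
Proof. by rewrite -big_split; apply: eq_bigr => i _; rewrite mxE mulrDl. Qed.

Lemma dotDr x y z : dot z (x + y) = dot z x + dot z y.
Proof. by rewrite !(dotC z) dotDl. Qed.

Lemma dotZl r x y : dot (r *: x) y = r * dot x y.
Proof. by rewrite mulr_sumr; apply: eq_bigr => i _; rewrite mxE mulrA. Qed.

Lemma dotZr r x y : dot x (r *: y) = r * dot x y.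
Proof. by rewrite dotC dotZl dotC. Qed.

Lemma dotNl x y : dot (- x) y = - dot x y.
Proof. by rewrite -scaleN1r dotZl mulN1r. Qed.

Lemma dotNr x y : dot x (- y) = - dot x y.
Proof. by rewrite dotC dotNl dotC. Qed.

Lemma dot0l x : dot 0 x = 0.
Proof. by rewrite -(scale0r 0) dotZl mul0r. Qed.

Lemma dot_delta x i : dot x (delta_mx 0 i) = x 0 i.
Proof.
rewrite /dot (bigD1 i)//= mxE !eqxx mulr1 big1 ?addr0// => j ji.
by rewrite mxE (negbTE ji) andbF mulr0.
Qed.

Lemma dot_ge0 x : 0 <= dot x x.
Proof. by apply: sumr_ge0 => i _; rewrite -expr2 sqr_ge0. Qed.

Lemma sqr_coord_le_dot x i : (x 0 i) ^+ 2 <= dot x x.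
Proof.
rewrite /dot (bigD1 i)//= -expr2 lerDl.
by apply: sumr_ge0 => j _; rewrite -expr2 sqr_ge0.
Qed.

Lemma dot_eq0 x : (dot x x == 0) = (x == 0).
Proof.
apply/eqP/eqP => [x0|->]; last exact: dot0l.
apply/rowP => i; rewrite mxE; apply/eqP; rewrite -sqrf_eq0 eq_le sqr_ge0 andbT.
by rewrite -x0 sqr_coord_le_dot.
Qed.

Lemma dot_gt0 x : x != 0 -> 0 < dot x x.
Proof. by move=> x0; rewrite lt_neqAle eq_sym dot_eq0 x0 dot_ge0. Qed.

(** Stands in for the Cauchy-Schwarz inequality; the factor [n] is the price of the sup norm. *)
Lemma norm_dot_le x y : `|dot x y| <= n%:R * `|x| * `|y|.
Proof.
rewrite (le_trans (ler_norm_sum _ _ _))//.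
rewrite -mulrA -[n in n%:R]card_ord mulr_natl -sumr_const ler_sum// => i _.
by rewrite normrM ler_pM// coord_le_norm.
Qed.

Lemma sqr_norm_le_dot x : `|x| ^+ 2 <= dot x x.
Proof.
rewrite -(sqr_sqrtr (dot_ge0 x)) ler_sqr ?nnegrE ?sqrtr_ge0//.
apply: norm_leP => [|i]; first exact: sqrtr_ge0.
by rewrite -sqrtr_sqr ler_wsqrtr// sqr_coord_le_dot.
Qed.

Lemma enorm_ge0 x : 0 <= enorm x. Proof. exact: sqrtr_ge0. Qed.

Lemma sqr_enorm x : enorm x ^+ 2 = dot x x.
Proof. by rewrite sqr_sqrtr// dot_ge0. Qed.

Lemma norm_le_enorm x : `|x| <= enorm x.
Proof. by rewrite -ler_sqr ?nnegrE ?enorm_ge0// sqr_enorm sqr_norm_le_dot. Qed.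

Lemma enorm_le_norm x : enorm x <= n%:R * `|x|.
Proof.
have [n0|n1] := eqVneq n 0%N.
  by rewrite /enorm /dot; move: x; rewrite n0 => x; rewrite big_ord0 sqrtr0 mul0r.
rewrite -ler_sqr ?nnegrE ?enorm_ge0 ?mulr_ge0// sqr_enorm.
apply: (le_trans (ler_norm _)); apply: (le_trans (norm_dot_le _ _)).
by rewrite exprMn expr2 -!mulrA ler_peMl ?ler1n ?lt0n// !mulr_ge0.
Qed.

End RowVectors.

(** * Difference quotients and almost everywhere derivability in R^n *)

Lemma rat_dense_rV (R : realType) (n : nat) (x : 'rV[R]_n) (e : R) : 0 < e ->
  exists q : 'rV[rat]_n, forall i, `|x 0 i - ratr (q 0 i)| <= e.
Proof.
move=> e0.
have /choice[f fP] (i : 'I_n) : exists q : rat, ratr q \in `](x 0 i - e), (x 0 i + e)[.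
  by apply: rat_in_itvoo; lra.
exists (\row_i f i) => i; rewrite mxE ler_norml.
by have := fP i; rewrite in_itv/= => /andP[? ?]; lra.
Qed.

Lemma nbhs_rat (R : realType) (s : R) (P : set R) :
  nbhs s P -> exists q : rat, P (ratr q).
Proof.
move=> /nbhs_ballP[e /= e0 eP].
have [|q] := @rat_in_itvoo R (s - e) (s + e); first by lra.
rewrite in_itv/= => /andP[q1 q2]; exists q; apply: eP.
by rewrite /ball/= ltr_norml; apply/andP; split; lra.
Qed.

Section DifferenceQuotients.
Context {R : realType} {V : normedModType R} (f : V -> R) (L : R).
Hypothesis fL : lip L f.
Implicit Types x h : V.

Definition quot h x (s : R) : R := s^-1 * (f (s *: h + x) - f x).

Lemma quot_continuous h x (s : R) : s != 0 -> {for s, continuous (quot h x)}.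
Proof.
move=> s0; apply: cvgM; first exact: inv_continuous.
apply: cvgB; last exact: cvg_cst.
apply: continuous_comp; last exact: (lip_continuous fL).
by apply: cvgD; [apply: cvgZr_tmp; exact: cvg_id|exact: cvg_cst].
Qed.

Lemma derivable_quotP h x : derivable f x h <->
  forall k, exists m, forall q q' : rat, q != 0 -> q' != 0 ->
    `|ratr q : R| < m.+1%:R^-1 -> `|ratr q' : R| < m.+1%:R^-1 ->
    `|quot h x (ratr q) - quot h x (ratr q')| <= k.+1%:R^-1.
Proof.
split.
  move=> /cvg_ex[l fl] k.
  have k0 : 0 < k.+1%:R^-1 / 2 :> R by rewrite divr_gt0.
  have [e /= e0 el] : nbhs_ball 0 (fun s : R => s != 0 -> `|l - quot h x s| < k.+1%:R^-1 / 2).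
    apply/nbhs_ballP.
    by move/cvgrPdist_lt: fl => /(_ _ k0); rewrite near_withinE.
  have [m me] : exists m, m.+1%:R^-1 < e.
    by have [m _ /(_ m (leqnn m))] := near_infty_natSinv_lt (PosNum e0); exists m.
  exists m => q q' q0 q'0 qm q'm.
  have H r : r != 0 -> `|ratr r : R| < m.+1%:R^-1 -> `|l - quot h x (ratr r)| < k.+1%:R^-1 / 2.
    move=> r0 rm; apply: el; last by rewrite fmorph_eq0.
    by rewrite /ball/= sub0r normrN (lt_trans rm).
  have := ler_distD l (quot h x (ratr q)) (quot h x (ratr q')).
  rewrite (distrC _ l) => /le_trans; apply.
  by rewrite [leRHS]splitr lerD// ltW// H.
move=> H; apply/cauchy_cvgP; apply/cauchyP => e e0.
have [k ke] : exists k, k.+1%:R^-1 < e.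
  by have [k _ /(_ k (leqnn k))] := near_infty_natSinv_lt (PosNum e0); exists k.
have [m Hm] := H k.
have m0 : 0 < m.+1%:R^-1 :> R by rewrite invr_gt0.
have [q0] := @rat_in_itvoo R 0 (m.+1%:R^-1) m0.
rewrite in_itv/= => /andP[q00 q0m].
exists (quot h x (ratr q0)).
change (\forall s \near (0 : R)^', ball (quot h x (ratr q0)) e (quot h x s)).
rewrite near_withinE; apply/nbhs_ballP; exists (m.+1%:R^-1) => //= s; rewrite /ball/= sub0r normrN => sm s0.
apply: le_lt_trans ke; rewrite leNgt; apply/negP => lt_k.
(* The quotient is continuous away from 0, so a real increment violating the bound has a rational
   neighbour that violates it as well. *)
have [q [[qk qm] q0']] : exists q : rat,
    (k.+1%:R^-1 < `|quot h x (ratr q0) - quot h x (ratr q)| /\ `|ratr q : R| < m.+1%:R^-1) /\ (ratr q : R) != 0.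
  apply: (@nbhs_rat R s (fun t => (k.+1%:R^-1 < `|quot h x (ratr q0) - quot h x t| /\ `|t| < m.+1%:R^-1) /\ t != 0)).
  have s00 : s != 0 by [].
  have c1 : `|quot h x (ratr q0) - quot h x t| @[t --> s] -->
      `|quot h x (ratr q0) - quot h x s|.
    by apply: cvg_norm; apply: cvgB; [exact: cvg_cst|exact: quot_continuous].
  have c2 : `|t| @[t --> s] --> `|s| by apply: cvg_norm; exact: cvg_id.
  near=> t; split; first split.
  - by near: t; exact: (cvgr_gt _ c1).
  - by near: t; exact: (cvgr_lt _ c2).
  - by near: t; apply: open_nbhs_nbhs; split => //; exact: open_neq.
move: qk; rewrite ltNge => /negP; apply; apply: Hm => //.
- by move: q00; rewrite lt0r fmorph_eq0 => /andP[].
- by move: q0'; rewrite fmorph_eq0.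
- by rewrite gtr0_norm.
Unshelve. all: by end_near. Qed.

End DifferenceQuotients.

Section Lebesgue.
Context {R : realType} {n : nat} (E : euclid_measure R n).
Local Notation T := (em_T E).
Local Notation mu := (em_mu E).
Local Notation X := (@em_X _ _ E).

(** Inf-convolution: [f] is the infimum, over rational vectors [q], of [f] at [q] plus [M] times the
    l1 distance to [q]. These functions are measurable because the coordinates are, and the strict
    sublevel sets of [f] are countable unions of theirs. *)
Lemma measurable_lip (L : R) (f : 'rV[R]_n -> R) : lip L f ->
  measurable_fun setT (f \o X).
Proof.
move=> /lip_gt0; set M := `|L| + 1 => fM.
have M0 : 0 < M by rewrite ltr_wpDl.
apply: (measurability _ (RGenInftyO.measurableE R)).
move=> _ [_ [a ->] <-]; rewrite setTI.
pose g (q : 'rV[rat]_n) (w : T) :=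
  f (map_mx ratr q) + M * \sum_(i < n) `|X w 0 i - ratr (q 0 i)|.
have mg q : measurable_fun setT (g q).
  apply: measurable_funD => //; apply: measurable_funM => //.
  apply: measurable_sum => i; apply: measurableT_comp => //.
  by apply: measurable_funB => //; exact: em_meas.
rewrite (_ : _ @^-1` _ = \bigcup_(q : 'rV[rat]_n) (g q @^-1` `]-oo, a[)).
  apply: countable_bigcupT_measurable => [|q]; first exact: countableP.
  by rewrite -[X in measurable X]setTI; exact: mg.
apply/seteqP; split => w /=; rewrite in_itv/=.
  (* The two errors, [M * e] from [f] and [n%:R * (M * e)] from the distance, add up to half of the
     gap [a - f (X w)]. *)
  move=> fa; pose e := (a - f (X w)) / (M * (2 * n.+1%:R)).
  have e0 : 0 < e by rewrite divr_gt0 ?subr_gt0// !mulr_gt0.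
  have [q qP] := rat_dense_rV (X w) e0.
  exists q => //=; rewrite in_itv/= /g.
  have qX : `|map_mx ratr q - X w| <= e.
    by apply: norm_leP => [|i]; [exact: ltW|rewrite !mxE distrC].
  have := fM (map_mx ratr q) (X w); rewrite ler_norml => /andP[_ fq].
  have sq : \sum_(i < n) `|X w 0 i - ratr (q 0 i)| <= n%:R * e.
    by rewrite -[n in n%:R]card_ord mulr_natl -sumr_const; exact: ler_sum.
  have Me : M * e * (2 * n.+1%:R) = a - f (X w).
    by rewrite /e; field; rewrite !gt_eqF.
  have Mq : M * `|map_mx ratr q - X w| <= M * e by rewrite ler_pM2l.
  have Ms : M * (\sum_(i < n) `|X w 0 i - ratr (q 0 i)|) <= M * (n%:R * e).
    by rewrite ler_pM2l.
  have Me0 : 0 < M * e by rewrite mulr_gt0.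
  have nMe0 : 0 <= n%:R * (M * e) by apply: mulr_ge0 => //; exact: ltW.
  rewrite -natr1 in Me; lra.
move=> [q _] /=; rewrite in_itv/=; apply: le_lt_trans; rewrite /g.
have := fM (X w) (map_mx ratr q); rewrite ler_norml => /andP[_].
rewrite lerBlDl => /le_trans; apply; rewrite lerD2l ler_pM2l//.
apply: norm_leP => [|i]; first by rewrite sumr_ge0.
by rewrite !mxE (bigD1 i)//= lerDl sumr_ge0.
Qed.

End Lebesgue.

Lemma countable_bigcapT_measurable (d : measure_display) (T : measurableType d)
    (I : countType) (F : I -> set T) :
  (forall i, measurable (F i)) -> measurable (\bigcap_i F i).
Proof.
move=> mF; rewrite -(setCK (\bigcap_i F i)) setC_bigcap; apply: measurableC.
apply: countable_bigcupT_measurable => [|i]; first exact: countableP.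
exact: measurableC.
Qed.

Lemma lip_shift (R : realType) (V : normedModType R) (L : R) (f : V -> R) (h : V) :
  lip L f -> lip L (fun x => f (h + x)).
Proof.
by move=> fL x y; rewrite (le_trans (fL _ _))// opprD addrACA subrr add0r.
Qed.

Section Rademacher.
Context {R : realType} {n : nat} (E : euclid_measure R n).
Local Notation T := (em_T E).
Local Notation mu := (em_mu E).
Local Notation X := (@em_X _ _ E).
Variables (f : 'rV[R]_n -> R) (L : R).
Hypothesis fL : lip L f.

Lemma measurable_quot h (s : R) : measurable_fun setT (fun w => quot f h (X w) s).
Proof.
apply: measurable_funM => //; apply: measurable_funB.
  exact: (measurable_lip (E := E) (lip_shift (s *: h) fL)).
exact: (measurable_lip (E := E) fL).
Qed.

Lemma measurable_derivable h : measurable [set w | derivable f (X w) h].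
Proof.
(* By continuity, Cauchy's criterion for the difference quotients need only be
   tested at the countably many rational increments. *)
pose F k m (q q' : rat) : set T :=
  if [&& q != 0, q' != 0, `|ratr q : R| < m.+1%:R^-1 & `|ratr q' : R| < m.+1%:R^-1]
  then [set w | `|quot f h (X w) (ratr q) - quot f h (X w) (ratr q')| <= k.+1%:R^-1]
  else setT.
rewrite (_ : [set w | _] =
  \bigcap_(k : nat) \bigcup_(m : nat) \bigcap_(q : rat) \bigcap_(q' : rat) F k m q q').
  apply: bigcapT_measurable => k; apply: bigcupT_measurable => m.
  apply: countable_bigcapT_measurable => q.
  apply: countable_bigcapT_measurable => q'.
  rewrite /F; case: ifPn => // _.
  rewrite -[X in measurable X]setTI.
  have mq : measurable_fun setT
      (fun w : T => `|quot f h (X w) (ratr q) - quot f h (X w) (ratr q')|).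
    by apply: measurableT_comp => //; apply: measurable_funB; exact: measurable_quot.
  have := mq measurableT `]-oo, k.+1%:R^-1]%classic (measurable_itv _).
  by congr (measurable _); apply/seteqP; split => w /=; rewrite in_itv.
apply/seteqP; split => w /=.
  move=> /(derivable_quotP fL) H k _; have [m Hm] := H k.
  exists m => // q _ q' _; rewrite /F; case: ifPn => //= /and4P[? ? ? ?].
  exact: Hm.
move=> H; apply/(derivable_quotP fL) => k; have [m _ Hm] := H k Logic.I.
exists m => q q' q0 q'0 qm q'm.
by have := Hm q Logic.I q' Logic.I; rewrite /F q0 q'0 qm q'm.
Qed.

Lemma lip_derivable_ae h : {ae mu, forall w, derivable f (X w) h}.
Proof.
(* Tonelli: averaging [N] over the translations by [t *: h], [0 < t < 1], does
   not change its measure, and reduces the claim to the lines of direction [h]. *)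
pose N := ~` [set w | derivable f (X w) h].
have mN : measurable N by apply: measurableC; exact: measurable_derivable.
exists N; split => //.
pose K : set (measurableTypeR R * T) :=
  (`]0, 1[ `*` setT) `&` ((fun z => em_shift (z.1 *: h) z.2) @^-1` N).
have mK : measurable K.
  apply: measurableI; first exact: measurableX.
  by rewrite -[X in measurable X]setTI; exact: em_shift_meas.
have K1 : (lebesgue_measure \x mu)%E K = mu N.
  transitivity (\int[@lebesgue_measure R]_t
      ((\1_(`]0%R, 1%R[%classic : set R) t)%:E * mu N))%E.
    apply: eq_integral => t _ /=; rewrite indicE.
    have [t01|t01] := boolP (t \in _).
      rewrite mul1e -(em_shift_mu (t *: h) mN); congr (mu _).
      rewrite /xsection/=; apply/seteqP; split => w /=; rewrite inE /K /=.
        by case.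
      by rewrite inE/= in t01.
    rewrite mul0e (_ : xsection _ _ = set0) ?measure0//.
    rewrite /xsection; apply/seteqP; split => w //=; rewrite inE /K /= => -[[t01' _] _].
    by move: t01; rewrite notin_setE; apply.
  rewrite ge0_integralZr//.
  - rewrite integral_indic// setIT.
    have l01 : lebesgue_measure (`]0%R, 1%R[%classic : set R) = 1%E.
      by rewrite lebesgue_measure_itv/= lte_fin ltr01 sube0.
    by rewrite [X in (X * _)%E]l01 mul1e.
  - exact/measurable_EFinP/measurable_indicP.
(* In the other order of integration, the section over [w] consists of the times at which [f] fails
   to be derivable along the line through [X w]. *)
have K2 : (lebesgue_measure \x mu)%E K = (lebesgue_measure \x^ mu)%E K.
  apply: product_measure_unique => // A B mA mB.
  by rewrite [LHS]product_measure2E.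
rewrite -K1 K2 /product_measure2 /=.
rewrite integral0_eq// => w _ /=.
pose g (t : R) := f (X w + t *: h).
have gL : lip (`|L| * `|h|) g.
  move=> s t; rewrite /g (le_trans (fL _ _))//.
  rewrite opprD addrACA subrr add0r -scalerBl normrZ.
  by rewrite (mulrC `|s - t|) mulrA !ler_wpM2r// ler_norm.
have [Z [mZ Z0 ZP]] := lipschitz_derivable_ae gL.
apply/eqP; rewrite eq_le measure_ge0 andbT -[leRHS]Z0.
apply: le_measure; rewrite ?inE//; first exact: measurable_ysection.
move=> t; rewrite /ysection /= inE /K /= => -[[t01 _] dN]; apply: ZP => /= dg.
apply: dN; have := dg t01.
rewrite /= (em_shiftE (t *: h) w) /derivable.
rewrite (_ : (fun s : R => _) = fun s => s^-1 *: ((f \o shift (X w + t *: h)) (s *: h) - f (X w + t *: h)))//.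
apply/funext => s; rewrite /g /=; congr (_ *: (f _ - _)).
by rewrite [s *: 1]mulr1 scalerDl addrCA.
Qed.

End Rademacher.

(** * Gradients and quadratic remainders *)

Section Gradient.
Context {R : realType} {n : nat}.
Implicit Types (f : 'rV[R]_n -> R) (x g h : 'rV[R]_n).

Lemma dot_is_linear g : linear (dot g).
Proof. by move=> k u v; rewrite dotDr dotZr. Qed.

Lemma lip_dot g : lip (n%:R * `|g|) (dot g).
Proof. by move=> x y; rewrite -dotNr -dotDr norm_dot_le. Qed.

(** The common route to differentiability for mollifications, barriers and affine functions; it
    identifies [grad] at the same time. *)
Lemma differentiable_of_remainder f x g (C : R) :
  (forall h, `|h| <= 1 -> `|f (h + x) - f x - dot g h| <= C * `|h| ^+ 2) ->
  differentiable f x /\ grad f x = g.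
Proof.
move=> fC.
pose dg : {linear 'rV[R]_n -> R} := HB.pack (dot g)
  (GRing.isLinear.Build _ _ _ _ _ (dot_is_linear g)).
have cdg : continuous dg by exact: lip_continuous (lip_dot g).
have dfx : f \o shift x = cst (f x) + dg +o_ (nbhs (0 : 'rV[R]_n)) id.
  apply/eqaddoP => e e0; change (\forall h \near (0 : 'rV[R]_n),
    `|(f \o shift x - (cst (f x) + dg)) h| <= e * `|h|).
  pose M := `|C| + 1.
  have M0 : 0 < M by rewrite ltr_wpDl.
  apply/nbhs_normP; exists (Num.min 1 (e / M)) => /=.
    by rewrite lt_min ltr01 divr_gt0.
  move=> h /=; rewrite sub0r normrN lt_min => /andP[/ltW h1 /ltW he].
  have -> : (f \o shift x - (cst (f x) + dg)) h = f (h + x) - f x - dot g h.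
    by rewrite /= opprD addrA.
  rewrite (le_trans (fC h h1))// expr2 mulrA ler_wpM2r//.
  apply: (@le_trans _ _ (M * `|h|)); last by rewrite mulrC -ler_pdivlMr.
  by rewrite ler_wpM2r// (le_trans (ler_norm _))// lerDl.
have dE : 'd f x = dg :> (_ -> _) by exact: diff_unique.
have df : differentiable f x by apply/diff_locallyP; rewrite dE.
split=> //; apply/rowP => i; rewrite mxE deriveE// dE.
exact: dot_delta.
Qed.

Lemma differentiable_grad f x h : differentiable f x -> 'D_h f x = dot (grad f x) h.
Proof.
move=> df; rewrite deriveE// [in LHS](row_sum_delta h) linear_sum.
by apply: eq_bigr => i _; rewrite linearZ /= mxE deriveE// mulrC.
Qed.

End Gradient.

(** * Mollification *)

Section Bump.
Context {R : realType} {n : nat} (r : R).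
Hypothesis r0 : 0 < r.
Implicit Types (x y h : 'rV[R]_n) (s t : R).

Definition pos_part (t : R) : R := Num.max 0 t.

Lemma pos_part_ge0 t : 0 <= pos_part t.
Proof. by rewrite le_max lexx. Qed.

Lemma pos_part_lip s t : `|pos_part s - pos_part t| <= `|s - t|.
Proof.
have [st|st] := ler0P (s - t); rewrite ler_norml /pos_part;
  by case: (leP 0 s) => ?; case: (leP 0 t) => ?; apply/andP; split; lra.
Qed.

(** The squared positive part has the derivative [2 * pos_part t], which is Lipschitz with constant
    2; hence a second-order remainder with constant 1. *)
Lemma pos_part_remainder s t :
  `|pos_part s ^+ 2 - pos_part t ^+ 2 - 2 * pos_part t * (s - t)| <= (s - t) ^+ 2.
Proof.
rewrite ler_norml /pos_part; have [s0|s0] := leP 0 s; have [t0|t0] := leP 0 t.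
- rewrite [X in _ <= X <= _](_ : _ = (s - t) ^+ 2); last by ring.
  by rewrite lexx andbT lerNl (le_trans _ (sqr_ge0 _))// oppr_le0 sqr_ge0.
- have st := mulr_ge0_le0 s0 (ltW t0); have tt := sqr_ge0 t; have ss := sqr_ge0 s.
  by rewrite expr0n !mulr0 mul0r !subr0 sqrrB; apply/andP; split; lra.
- have st := mulr_le0_ge0 (ltW s0) t0; have tt := sqr_ge0 t; have ss := sqr_ge0 s.
  rewrite [X in _ <= X <= _](_ : _ = t ^+ 2 - s * t *+ 2); last by ring.
  by rewrite sqrrB; apply/andP; split; lra.
- rewrite expr0n !mulr0 mul0r !subr0 sqr_ge0 andbT oppr_le0.
  exact: sqr_ge0.
Qed.

(** Squaring the positive part makes the kernel C^1 with Lipschitz gradient, and test functions have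
    to be C^1 only. The normalization is left to [bump_mass]. *)
Definition bump y : R := pos_part (r ^+ 2 - dot y y) ^+ 2.

(* [dbump] is minus the gradient of [bump], since mollification differentiates
   [bump (x - c)] with respect to the centre [c]. *)
Definition dbump y : 'rV[R]_n := (4 * pos_part (r ^+ 2 - dot y y)) *: y.

Lemma bump_ge0 y : 0 <= bump y. Proof. exact: sqr_ge0. Qed.

Lemma pos_part_out y : r < `|y| -> pos_part (r ^+ 2 - dot y y) = 0.
Proof.
move=> ry; rewrite /pos_part; apply/max_idPl; rewrite subr_le0.
by rewrite (le_trans _ (sqr_norm_le_dot y))// ler_sqr ?nnegrE ?normr_ge0 ?ltW.
Qed.

Lemma bump_out y : r < `|y| -> bump y = 0.
Proof. by move=> ry; rewrite /bump pos_part_out// expr0n. Qed.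

Lemma dbump_out y : r < `|y| -> dbump y = 0.
Proof. by move=> ry; rewrite /dbump pos_part_out// mulr0 scale0r. Qed.

Lemma pos_part_le y : pos_part (r ^+ 2 - dot y y) <= r ^+ 2.
Proof. by rewrite ge_max sqr_ge0/= gerBl dot_ge0. Qed.

Lemma bump_le y : bump y <= r ^+ 4.
Proof.
by rewrite /bump (exprM r 2 2) ler_sqr ?nnegrE ?pos_part_ge0 ?sqr_ge0// pos_part_le.
Qed.

Lemma norm_dbump_le y : `|dbump y| <= 4 * r ^+ 2 * r.
Proof.
have [ry|yr] := ltP r `|y|.
  by rewrite dbump_out// normr0 !mulr_ge0 ?sqr_ge0 ?ltW.
rewrite normrZ ler_pM// ger0_norm ?mulr_ge0 ?pos_part_ge0//.
by rewrite ler_wpM2l// pos_part_le.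
Qed.

Let far y h : r + 1 < `|y| -> `|h| <= 1 -> r < `|y - h|.
Proof. by move=> ry h1; have := lerB_dist y h; lra. Qed.

Let bump_diff y h :
  (r ^+ 2 - dot (y - h) (y - h)) - (r ^+ 2 - dot y y) = 2 * dot y h - dot h h.
Proof.
by rewrite !(dotDl, dotDr, dotNl, dotNr) (dotC h y); ring.
Qed.

Let bump_diff_le y h : `|y| <= r + 1 -> `|h| <= 1 ->
  `|2 * dot y h - dot h h| <= n%:R * (2 * r + 3) * `|h|.
Proof.
move=> yr h1; rewrite (le_trans (ler_normB _ _))// normrM ger0_norm//.
have yh : `|dot y h| <= n%:R * (r + 1) * `|h|.
  rewrite (le_trans (norm_dot_le _ _))//.
  by apply: ler_wpM2r => //; apply: ler_wpM2l.
have hh : `|dot h h| <= n%:R * 1 * `|h|.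
  rewrite (le_trans (norm_dot_le _ _))//.
  by apply: ler_wpM2r => //; apply: ler_wpM2l.
have n0 : 0 <= n%:R :> R by [].
nra.
Qed.

(** The remainder also has bounded support, in a radius enlarged by 1 to make room for [h]; thus it
    can be integrated against an unbounded Lipschitz function. *)
Lemma bump_remainder : exists C, forall y h, `|h| <= 1 ->
  `|bump (y - h) - bump y - dot (dbump y) h| <= C * `|h| ^+ 2 /\
  (r + 1 < `|y| -> bump (y - h) - bump y - dot (dbump y) h = 0).
Proof.
(* The first term is the square of the increment bound [bump_diff_le], as it comes out of
   [pos_part_remainder]; the second bounds the contribution of [dot h h]. *)
exists ((n%:R * (2 * r + 3)) ^+ 2 + 2 * r ^+ 2 * n%:R) => y h h1.
have out : r + 1 < `|y| -> bump (y - h) - bump y - dot (dbump y) h = 0.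
  move=> ry; have ry' : r < `|y| by rewrite (lt_trans _ ry)// ltrDl.
  by rewrite bump_out ?far// bump_out// dbump_out// dot0l !subrr.
split=> //; have [ry|yr] := ltP (r + 1) `|y|.
  rewrite out// normr0; apply: mulr_ge0; last exact: sqr_ge0.
  apply: addr_ge0; first exact: sqr_ge0.
  by apply: mulr_ge0 => //; apply: mulr_ge0 => //; exact: sqr_ge0.
have -> : bump (y - h) - bump y - dot (dbump y) h =
  (pos_part (r ^+ 2 - dot (y - h) (y - h)) ^+ 2 - pos_part (r ^+ 2 - dot y y) ^+ 2
   - 2 * pos_part (r ^+ 2 - dot y y) *
     ((r ^+ 2 - dot (y - h) (y - h)) - (r ^+ 2 - dot y y)))
  - 2 * pos_part (r ^+ 2 - dot y y) * dot h h.
  by rewrite bump_diff /bump /dbump dotZl; ring.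
rewrite (le_trans (ler_normB _ _))// [leRHS]mulrDl lerD//.
  rewrite (le_trans (pos_part_remainder _ _))// bump_diff -exprMn.
  rewrite -[leLHS]ger0_norm ?sqr_ge0// normrX ler_sqr ?nnegrE ?normr_ge0//.
    exact: bump_diff_le.
  by rewrite !mulr_ge0// addr_ge0// mulr_ge0// ltW.
rewrite normrM ger0_norm ?mulr_ge0 ?pos_part_ge0// -mulrA.
rewrite [leRHS](_ : _ = 2 * (r ^+ 2 * (n%:R * `|h| * `|h|))); last by ring.
rewrite -(mulrA 2 (pos_part _)); apply: ler_wpM2l => //; apply: ler_pM; rewrite ?pos_part_ge0 ?normr_ge0 ?pos_part_le//.
exact: norm_dot_le.
Qed.

Lemma dbump_lip : exists C, forall y h, `|h| <= 1 ->
  `|dbump (y - h) - dbump y| <= C * `|h| /\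
  (r + 1 < `|y| -> dbump (y - h) - dbump y = 0).
Proof.
exists (4 * (n%:R * (2 * r + 3)) * (r + 2) + 4 * r ^+ 2) => y h h1.
have out : r + 1 < `|y| -> dbump (y - h) - dbump y = 0.
  move=> ry; have ry' : r < `|y| by rewrite (lt_trans _ ry)// ltrDl.
  by rewrite dbump_out ?far// dbump_out// subrr.
split=> //; have [ry|yr] := ltP (r + 1) `|y|.
  have r20 : 0 <= 2 * r + 3 by rewrite addr_ge0// mulr_ge0// ltW.
  have r2 : 0 <= r + 2 by rewrite addr_ge0// ltW.
  by rewrite out// normr0 mulr_ge0// addr_ge0// mulr_ge0// ?sqr_ge0// !mulr_ge0.
have E1 : dbump (y - h) - dbump y =
  (4 * (pos_part (r ^+ 2 - dot (y - h) (y - h)) - pos_part (r ^+ 2 - dot y y)))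
    *: (y - h) - (4 * pos_part (r ^+ 2 - dot y y)) *: h.
  by rewrite /dbump mulrBr scalerBl -addrA -opprD -scalerDr subrK.
rewrite E1 (le_trans (ler_normB _ _))// [leRHS]mulrDl lerD// normrZ.
  rewrite mulrAC ler_pM//.
    rewrite normrM ger0_norm// -mulrA ler_wpM2l//.
    rewrite (le_trans (pos_part_lip _ _))// bump_diff.
    exact: bump_diff_le.
  by rewrite (le_trans (ler_normB _ _))//; lra.
rewrite ler_wpM2r// ger0_norm ?mulr_ge0 ?pos_part_ge0//.
by rewrite ler_wpM2l// pos_part_le.
Qed.

End Bump.

Section CompactlySupported.
Context {R : realType} {n : nat} (E : euclid_measure R n).
Local Notation T := (em_T E).
Local Notation mu := (em_mu E).
Local Notation X := (@em_X _ _ E).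
Implicit Types (g : T -> R) (A B : R).

(** Every integrand below is bounded by some [A] and vanishes outside a cube of half-side [B].
    Recording both constants yields integrability and an explicit bound on the integral. *)
Definition csupp A B g := measurable_fun setT g /\
  forall w, `|g w| <= A /\ (B < `|X w| -> g w = 0).

Let cube B := X @^-1` box (const_mx (- B)) (const_mx B).

Lemma cubeP B w : 0 <= B -> cube B w <-> `|X w| <= B.
Proof.
move=> B0; rewrite /cube/= /box/=; split => [H|H i].
  by apply: norm_leP => // i; have := H i; rewrite !mxE ler_norml.
by rewrite !mxE -ler_norml (le_trans (coord_le_norm _ _)).
Qed.

Lemma measurable_cube B : measurable (cube B).
Proof. by apply: measurable_box; exact: em_meas. Qed.

Lemma mu_cube B : 0 <= B -> mu (cube B) = ((2 * B) ^+ n)%:E.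
Proof.
move=> B0; rewrite /cube em_box => [|i]; last by rewrite !mxE lerNl; lra.
congr EFin; rewrite -[n in RHS]card_ord -prodr_const.
by apply: eq_bigr => i _; rewrite !mxE; ring.
Qed.

Lemma integrable_cube1 B : 0 <= B -> mu.-integrable setT (EFin \o \1_(cube B)).
Proof.
move=> B0; apply/integrableP; split.
  by apply/measurable_EFinP/measurable_indicP; exact: measurable_cube.
under eq_integral do rewrite /= ger0_norm//.
rewrite integral_indic ?setIT//; last exact: measurable_cube.
by rewrite [X in (X < _)%E](mu_cube B0) ltry.
Qed.

Lemma integrable_cube A B : 0 <= B ->
  mu.-integrable setT (EFin \o (fun w => A * \1_(cube B) w)).
Proof.
move=> B0; have := integrable_cube1 B0.
by move/(integrableZl measurableT A); apply: eq_integrable => // w _ /=; rewrite EFinM.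
Qed.

Lemma csupp_le_cube A B g w : 0 <= B -> csupp A B g -> `|g w| <= A * \1_(cube B) w.
Proof.
move=> B0 gAB; have [gA gB] := gAB.2 w; rewrite indicE.
have [|wB] := boolP (w \in _); first by rewrite mulr1.
rewrite gB ?normr0 ?mulr0// ltNge; apply: contra wB => /(cubeP w B0) wB.
by rewrite inE.
Qed.

Lemma csuppW A A' B B' g : A <= A' -> B <= B' -> csupp A B g -> csupp A' B' g.
Proof.
move=> AA' BB' [mg H]; split=> // w; have [gA gB] := H w.
by split=> [|Bw]; [exact: le_trans AA'|rewrite gB// (le_lt_trans BB')].
Qed.

Lemma csupp_integrable A B g : csupp A B g -> mu.-integrable setT (EFin \o g).
Proof.
move=> gAB0; pose M := Num.max 0 B.
have gAB : csupp A M g by apply: csuppW gAB0; rewrite // le_max lexx orbT.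
have M0 : 0 <= M by rewrite le_max lexx.
apply: (le_integrable measurableT _ _ (integrable_cube A M0)).
  by apply/measurable_EFinP; exact: gAB.1.
move=> w _; rewrite /= lee_fin.
by rewrite (le_trans (csupp_le_cube w M0 gAB))// ler_norm.
Qed.

Lemma csupp_norm_integral A B g : 0 <= B -> csupp A B g ->
  `|\int[mu]_w g w| <= A * (2 * B) ^+ n.
Proof.
move=> B0 gAB; have gi := csupp_integrable gAB.
rewrite (le_trans (le_normr_Rintegral measurableT gi))//.
have [mg _] := gAB.
have gabs : csupp A B (fun w => `|g w|).
  split; first exact: measurableT_comp.
  by move=> w; rewrite normr_id; have [? H] := gAB.2 w; split=> // /H ->; rewrite normr0.
rewrite (le_trans (le_Rintegral measurableT (csupp_integrable gabs) (integrable_cube A B0) _))//.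
  by move=> w _; exact: csupp_le_cube.
rewrite RintegralZl//.
  rewrite /Rintegral integral_indic ?setIT//; last exact: measurable_cube.
  by rewrite [X in fine X](mu_cube B0).
exact: integrable_cube1.
Qed.

Lemma csuppD A A' B g g' : csupp A B g -> csupp A' B g' ->
  csupp (A + A') B (fun w => g w + g' w).
Proof.
move=> [mg H] [mg' H']; split; first exact: measurable_funD.
move=> w; have [gA gB] := H w; have [gA' gB'] := H' w.
split=> [|Bw]; first by rewrite (le_trans (ler_normD _ _))// lerD.
by rewrite gB// gB'// addr0.
Qed.

Lemma csuppZ k A B g : csupp A B g -> csupp (`|k| * A) B (fun w => k * g w).
Proof.
move=> [mg H]; split; first exact: measurable_funM.
move=> w; have [gA gB] := H w.
by split=> [|Bw]; [rewrite normrM ler_wpM2l|rewrite gB ?mulr0].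
Qed.

Lemma csuppM A A' B g g' : measurable_fun setT g' ->
  (forall w, `|X w| <= B -> `|g' w| <= A') -> 0 <= A' ->
  csupp A B g -> csupp (A' * A) B (fun w => g' w * g w).
Proof.
move=> mg' H' A'0 [mg H]; split; first exact: measurable_funM.
move=> w; have [gA gB] := H w.
split=> [|Bw]; last by rewrite gB ?mulr0.
have [wB|Bw] := leP `|X w| B; first by rewrite normrM ler_pM// H'.
by rewrite gB// mulr0 normr0 mulr_ge0// (le_trans _ gA).
Qed.

Lemma integral_shift h (F : 'rV[R]_n -> R) :
  measurable_fun setT (F \o X) -> mu.-integrable setT (EFin \o (F \o X)) ->
  measurable_fun setT (fun w => F (X w + h)) ->
  mu.-integrable setT (EFin \o (fun w => F (X w + h))) ->
  \int[mu]_w F (X w + h) = \int[mu]_w F (X w).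
Proof.
move=> mF iF mFh iFh.
have msh : measurable_fun setT (@em_shift _ _ E h).
  have := measurableT_comp (@em_shift_meas _ _ E h) (pair1_measurable (1 : measurableTypeR R)).
  by apply: eq_measurable_fun => w _ /=; rewrite scale1r.
rewrite /Rintegral; congr fine.
have FhE : EFin \o (fun w => F (X w + h)) = (EFin \o (F \o X)) \o (@em_shift _ _ E h).
  by apply/funext => w /=; rewrite em_shiftE.
transitivity (\int[pushforward mu (@em_shift _ _ E h)]_w (F (X w))%:E)%E.
  rewrite integral_pushforward//.
  - by apply: eq_integral => w _ /=; rewrite em_shiftE.
  - exact/measurable_EFinP.
  - by rewrite preimage_setT -FhE.
apply: (@eq_measure_integral _ _ _ setT mu
  (measure_function_pushforward__canonical__measure_function_Measure mu msh)).
by move=> A mA _; exact: em_shift_mu.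
Qed.

End CompactlySupported.

Section Mollifier.
Context {R : realType} {n : nat} (E : euclid_measure R n).
Local Notation T := (em_T E).
Local Notation mu := (em_mu E).
Local Notation X := (@em_X _ _ E).
Variable r : R.
Hypothesis r0 : 0 < r.
Implicit Types (c x h : 'rV[R]_n) (g : T -> R).

Lemma measurable_coord c i : measurable_fun setT (fun w => (X w - c) 0 i).
Proof.
by under eq_fun do rewrite !mxE; apply: measurable_funB => //; exact: em_meas.
Qed.

Lemma measurable_cutoff c :
  measurable_fun setT (fun w => pos_part (r ^+ 2 - dot (X w - c) (X w - c))).
Proof.
apply: measurable_maxr => //; apply: measurable_funB => //.
by apply: measurable_sum => i; apply: measurable_funM; exact: measurable_coord.
Qed.

Lemma measurable_bump c : measurable_fun setT (fun w => bump r (X w - c)).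
Proof. by apply: measurable_funX; exact: measurable_cutoff. Qed.

Lemma measurable_dbump c i : measurable_fun setT (fun w => dbump r (X w - c) 0 i).
Proof.
under eq_fun do rewrite mxE; apply: measurable_funM; last exact: measurable_coord.
by apply: measurable_funM => //; exact: measurable_cutoff.
Qed.

Lemma far_center c (s : R) w : s + `|c| < `|X w| -> s < `|X w - c|.
Proof. by move=> H; have := lerB_dist (X w) c; lra. Qed.

Lemma csupp_bump c : csupp (r ^+ 4) (r + `|c|) (fun w => bump r (X w - c)).
Proof.
split; first exact: measurable_bump.
move=> w; split=> [|/far_center]; last exact: bump_out.
by rewrite ger0_norm ?bump_ge0// bump_le.
Qed.

Lemma integral_bump c : \int[mu]_w bump r (X w - c) = \int[mu]_w bump r (X w).
Proof.
have e : (fun w => bump r (X w)) = (fun w => bump r (X w - 0)).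
  by apply/funext => w; rewrite subr0.
apply: (@integral_shift _ _ E (- c) (bump r)).
- by rewrite [X in measurable_fun _ X]e; exact: measurable_bump.
- rewrite (_ : bump r \o X = fun w => bump r (X w - 0)); last exact: e.
  exact: csupp_integrable (csupp_bump 0).
- exact: measurable_bump.
- exact: csupp_integrable (csupp_bump c).
Qed.

Definition bump_mass : R := \int[mu]_w bump r (X w).
Local Notation Z := bump_mass.

Lemma bump_mass_gt0 : 0 < Z.
Proof.
(* On the cube of half-side [e] one has [dot y y <= n%:R * e * e <= r ^+ 2 / 4], so the kernel is at
   least [A] there. *)
pose e := r / (2 * n.+1%:R); have e0 : 0 < e by rewrite divr_gt0.
pose A := (r ^+ 2 / 2) ^+ 2; have A0 : 0 < A by rewrite exprn_gt0// divr_gt0// exprn_gt0.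
have le_bump w : A * \1_(X @^-1` box (const_mx (- e)) (const_mx e)) w <= bump r (X w).
  rewrite indicE; have [|_] := boolP (w \in _); last by rewrite mulr0 bump_ge0.
  rewrite inE => /(cubeP w (ltW e0)) Xe; rewrite mulr1.
  rewrite ler_sqr ?nnegrE ?pos_part_ge0 ?divr_ge0 ?sqr_ge0//.
  rewrite le_max; apply/orP; right.
  have : dot (X w) (X w) <= n%:R * e * e.
    rewrite (le_trans (ler_norm _))// (le_trans (norm_dot_le _ _))//.
    by apply: ler_pM => //; exact: ler_wpM2l.
  have ne : n.+1%:R * e = r / 2 by rewrite /e; field.
  have e1 : e <= r / 2.
    by rewrite -ne; apply: ler_peMl; [exact: ltW|rewrite ler1n].
  have ne' : n%:R * e <= r / 2 by rewrite -ne; apply: ler_wpM2r; [exact: ltW|rewrite ler_nat].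
  have : n%:R * e * e <= r / 2 * (r / 2).
    by apply: ler_pM => //; [apply: mulr_ge0 => //|]; exact: ltW.
  have := sqr_ge0 r; rewrite expr2; lra.
have ib : mu.-integrable setT (EFin \o (fun w => bump r (X w))).
  have := csupp_integrable (csupp_bump 0).
  by apply: eq_integrable => // w _ /=; rewrite subr0.
apply: lt_le_trans (le_Rintegral measurableT (integrable_cube E A (ltW e0)) ib _) => //.
rewrite RintegralZl//; last exact: integrable_cube1 (ltW e0).
rewrite /Rintegral integral_indic ?setIT//; last exact: measurable_cube.
rewrite [X in _ * fine X](mu_cube E (ltW e0))/= mulr_gt0// exprn_gt0//.
by rewrite mulr_gt0.
Qed.

Lemma bump_average_le c g (a A B : R) :
  csupp A B (fun w => g w * bump r (X w - c)) ->
  (forall w, `|X w - c| <= r -> g w <= a) ->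
  Z^-1 * \int[mu]_w (g w * bump r (X w - c)) <= a.
Proof.
move=> gAB ga; rewrite ler_pdivrMl ?bump_mass_gt0//.
rewrite mulrC /bump_mass -(integral_bump c) -RintegralZl//; last exact: csupp_integrable (csupp_bump c).
apply: le_Rintegral => //; first exact: csupp_integrable gAB.
  exact: csupp_integrable (csuppZ a (csupp_bump c)).
move=> w _; have [Xr|rX] := leP `|X w - c| r; last by rewrite bump_out// !mulr0.
by rewrite ler_wpM2r ?bump_ge0// ga.
Qed.

Section Lipschitz.
Variables (f : 'rV[R]_n -> R) (L : R).
Hypotheses (L0 : 0 <= L) (fL : lip L f).

Definition mollify c : R := Z^-1 * \int[mu]_w (f (X w) * bump r (X w - c)).

Lemma lip_bound x : `|f x| <= `|f 0| + L * `|x|.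
Proof.
have := fL x 0; rewrite subr0 => fx.
by rewrite -[f x](subrK (f 0)) (le_trans (ler_normD _ _))// addrC lerD2l.
Qed.

Lemma csupp_lip h (A B : R) g : 0 <= B -> csupp A B g ->
  csupp ((`|f 0| + L * (B + `|h|)) * A) B (fun w => f (X w + h) * g w).
Proof.
move=> B0 gAB; apply: csuppM gAB.
- apply: (measurable_lip (E := E) (f := fun x => f (x + h)) (L := L)).
  by move=> x y; rewrite (le_trans (fL _ _))// opprD addrACA subrr addr0.
- move=> w wB; rewrite (le_trans (lip_bound _))// lerD2l ler_wpM2l//.
  by rewrite (le_trans (ler_normD _ _))// lerD2r.
- by rewrite addr_ge0// mulr_ge0// addr_ge0.
Qed.

Lemma csupp_mollify h c : csupp
  ((`|f 0| + L * ((r + `|c|) + `|h|)) * r ^+ 4) (r + `|c|)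
  (fun w => f (X w + h) * bump r (X w - c)).
Proof. by apply: csupp_lip (csupp_bump c); rewrite addr_ge0// ltW. Qed.

Lemma csupp_mollify0 c : csupp
  ((`|f 0| + L * ((r + `|c|) + `|0 : 'rV[R]_n|)) * r ^+ 4) (r + `|c|)
  (fun w => f (X w) * bump r (X w - c)).
Proof.
have := csupp_mollify 0 c; congr csupp; apply/funext => w.
by rewrite addr0.
Qed.

(** In [mollify] the centre sits in the kernel, which is what makes the result smooth. Translation
    invariance moves an increment of the centre over to [f], where bounds on increments are
    known. *)
Lemma mollify_shift c h :
  mollify (c + h) = Z^-1 * \int[mu]_w (f (X w + h) * bump r (X w - c)).
Proof.
congr (_ * _).
have e : (fun w => f (X w + h) * bump r (X w + h - (c + h))) =
         (fun w => f (X w + h) * bump r (X w - c)).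
  by apply/funext => w; rewrite opprD addrACA subrr addr0.
transitivity (\int[mu]_w (f (X w + h) * bump r (X w + h - (c + h)))); last by rewrite e.
apply/esym/(@integral_shift _ _ E h (fun x => f x * bump r (x - (c + h)))).
- exact: (csupp_mollify0 (c + h)).1.
- exact: csupp_integrable (csupp_mollify0 (c + h)).
- by rewrite e; exact: (csupp_mollify h c).1.
- by rewrite e; exact: csupp_integrable (csupp_mollify h c).
Qed.

(** An average inherits one-sided bounds without loss, so a half space for the increments of [f] is
    preserved exactly. *)
Lemma mollify_increment_le c h (a : R) :
  (forall x, `|x - c| <= r -> f (x + h) - f x <= a) ->
  mollify (c + h) - mollify c <= a.
Proof.
move=> fa; rewrite mollify_shift /mollify -mulrBr -RintegralB//; last 2 first.
- exact: csupp_integrable (csupp_mollify h c).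
- exact: csupp_integrable (csupp_mollify0 c).
have := csuppD (csupp_mollify h c) (csuppZ (-1) (csupp_mollify0 c)).
set A := (X in csupp X); set g := (X in csupp _ _ X) => gA.
rewrite (_ : (fun w => _ - _) = fun w => (f (X w + h) - f (X w)) * bump r (X w - c)); last first.
  by apply/funext => w; rewrite mulrBl.
apply: (@bump_average_le c (fun w => f (X w + h) - f (X w)) a A (r + `|c|)).
  by move: gA; congr csupp; apply/funext => w; rewrite /g mulN1r mulrBl.
by move=> w wr; exact: fa.
Qed.

Lemma mollify_lip : lip L mollify.
Proof.
move=> x y.
have H u v : mollify u - mollify v <= L * `|u - v|.
  rewrite -{1}(subrKC v u); apply: mollify_increment_le => z _.
  have := fL (z + (u - v)) z; rewrite addrAC subrr add0r.
  exact: le_trans (ler_norm _).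
by rewrite ler_norml H andbT lerNl opprB distrC.
Qed.

Lemma mollify_close c : `|mollify c - f c| <= L * r.
Proof.
have fc : f c = Z^-1 * \int[mu]_w (f c * bump r (X w - c)).
  rewrite RintegralZl//; last exact: csupp_integrable (csupp_bump c).
  by rewrite integral_bump -/bump_mass mulrC mulfK// gt_eqF// bump_mass_gt0.
have gA := csuppD (csupp_mollify0 c) (csuppZ (- f c) (csupp_bump c)).
have diffE : mollify c - f c = Z^-1 * \int[mu]_w ((f (X w) - f c) * bump r (X w - c)).
  rewrite {1}fc /mollify -mulrBr -RintegralB//.
  - by congr (_ * _); apply: eq_Rintegral => w _; rewrite mulrBl.
  - exact: csupp_integrable (csupp_mollify0 c).
  - exact: csupp_integrable (csuppZ (f c) (csupp_bump c)).
rewrite ler_norml; apply/andP; split.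
  rewrite lerNl diffE -mulrN -mulN1r -RintegralZl//; last first.
    have := csupp_integrable gA; apply: eq_integrable => // w _ /=.
    by rewrite mulrBl mulNr.
  rewrite (_ : (fun w => _ * _) = fun w => (f c - f (X w)) * bump r (X w - c)); last first.
    by apply/funext => w; rewrite mulrA mulN1r opprB.
  apply: (bump_average_le (A := `|-1| * _) (B := r + `|c|)).
    have := csuppZ (-1) gA; congr csupp; apply/funext => w.
    by rewrite mulN1r mulNr -mulrBl -mulNr opprB.
  move=> w wr; rewrite (le_trans (ler_norm _))// distrC (le_trans (fL _ _))//.
  by rewrite ler_wpM2l.
rewrite diffE; apply: bump_average_le.
  move: gA; congr csupp; apply/funext => w; by rewrite mulNr -mulrBl.
move=> w wr; rewrite (le_trans (ler_norm _))// (le_trans (fL _ _))//.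
by rewrite ler_wpM2l.
Qed.

End Lipschitz.
End Mollifier.

Lemma Rintegral_sum (R : realType) (d : measure_display) (T : measurableType d)
    (mu : {measure set T -> \bar R}) (J : Type) (s : seq J) (F : J -> T -> R) :
  (forall j, mu.-integrable setT (EFin \o F j)) ->
  mu.-integrable setT (EFin \o (fun w => \sum_(j <- s) F j w)) /\
  \int[mu]_w (\sum_(j <- s) F j w) = \sum_(j <- s) \int[mu]_w F j w.
Proof.
move=> iF; elim: s => [|j s [iS IH]].
  rewrite big_nil; have -> : (fun w => \sum_(j <- [::]) F j w) = cst 0.
    by apply/funext => w; rewrite big_nil.
  split; first exact: integrable0.
  by rewrite Rintegral_cst// mul0r.
have -> : (fun w => \sum_(i <- j :: s) F i w) = fun w => F j w + \sum_(i <- s) F i w.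
  by apply/funext => w; rewrite big_cons.
split; first exact: (integrableD measurableT (iF j) iS).
by rewrite RintegralD// IH big_cons.
Qed.

Lemma continuous_of_modulus (R : realType) (V : normedModType R) (f : V -> R)
    (x : V) (M : R) :
  (forall h, `|h| <= 1 -> `|f (x + h) - f x| <= M * `|h|) ->
  {for x, continuous f}.
Proof.
move=> HM; have M1 : 0 < `|M| + 1 by rewrite ltr_wpDl.
apply/cvgrPdist_le => e e0; apply/nbhs_normP.
exists (Num.min 1 (e / (`|M| + 1))) => /=; first by rewrite lt_min ltr01 divr_gt0.
move=> y /=; rewrite lt_min distrC => /andP[/ltW y1 /ltW ye].
have := HM (y - x) y1; rewrite subrKC distrC => H.
rewrite (le_trans H)// (@le_trans _ _ ((`|M| + 1) * `|y - x|))//.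
  by rewrite ler_wpM2r// (le_trans (ler_norm _))// lerDl.
by rewrite mulrC -ler_pdivlMr.
Qed.

Section MollifierC1.
Context {R : realType} {n : nat} (E : euclid_measure R n).
Local Notation T := (em_T E).
Local Notation mu := (em_mu E).
Local Notation X := (@em_X _ _ E).
Variable r : R.
Hypothesis r0 : 0 < r.
Variables (f : 'rV[R]_n -> R) (L : R).
Hypotheses (L0 : 0 <= L) (fL : lip L f).
Local Notation Z := (bump_mass E r).
Local Notation fr := (mollify E r f).

Definition mollify_grad c : 'rV[R]_n :=
  \row_i (Z^-1 * \int[mu]_w (f (X w) * dbump r (X w - c) 0 i)).

Lemma csupp_lip0 (A B : R) (g : T -> R) : 0 <= B -> csupp A B g ->
  csupp ((`|f 0| + L * B) * A) B (fun w => f (X w) * g w).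
Proof.
move=> B0 /(csupp_lip L0 fL 0 B0); rewrite normr0 addr0; congr csupp.
by apply/funext => w; rewrite addr0.
Qed.

Lemma csupp_dbump c i :
  csupp (4 * r ^+ 2 * r) (r + `|c|) (fun w => dbump r (X w - c) 0 i).
Proof.
split; first exact: measurable_dbump.
move=> w; split=> [|/far_center /(dbump_out r0) ->]; last by rewrite mxE.
exact: le_trans (coord_le_norm _ _) (norm_dbump_le r0 _).
Qed.

Lemma rc0 (c : 'rV[R]_n) : 0 <= r + `|c|.
Proof. by rewrite addr_ge0// ltW. Qed.

Lemma Zinv_ge0 : 0 <= Z^-1.
Proof. by rewrite invr_ge0 ltW// bump_mass_gt0. Qed.

(** By linearity the remainder of the mollification is the integral of [f] against the remainder of
    the kernel, which is of size [C * |h|^2] on a fixed ball. *)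
Lemma mollify_remainder c : exists C, forall h, `|h| <= 1 ->
  `|fr (h + c) - fr c - dot (mollify_grad c) h| <= C * `|h| ^+ 2.
Proof.
have [C HC] := bump_remainder (n := n) r0.
pose B := r + 1 + `|c|; have B0 : 0 <= B by rewrite !addr_ge0// ltW.
exists (Z^-1 * ((`|f 0| + L * B) * C * (2 * B) ^+ n)) => h h1.
pose rem w := bump r (X w - c - h) - bump r (X w - c) - dot (dbump r (X w - c)) h.
have mrem : measurable_fun setT rem.
  apply: measurable_funB; first apply: measurable_funB.
  - rewrite (_ : (fun w => _) = fun w => bump r (X w - (c + h))).
      exact: measurable_bump.
    by apply/funext => w; rewrite opprD addrA.
  - exact: measurable_bump.
  - by apply: measurable_sum => i; apply: measurable_funM => //; exact: measurable_dbump.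
have srem : csupp (C * `|h| ^+ 2) B rem.
  split=> // w; have [? H] := HC (X w - c) h h1; split=> //.
  by move=> /far_center; exact: H.
have fi (i : 'I_n) : mu.-integrable setT
    (EFin \o (fun w => h 0 i * (f (X w) * dbump r (X w - c) 0 i))).
  exact: csupp_integrable (csuppZ _ (csupp_lip0 (rc0 c) (csupp_dbump c i))).
have [iS iSE] := Rintegral_sum (index_enum 'I_n) fi.
have dotE : dot (mollify_grad c) h = Z^-1 *
    \int[mu]_w (\sum_(i < n) h 0 i * (f (X w) * dbump r (X w - c) 0 i)).
  rewrite iSE mulr_sumr; apply: eq_bigr => i _.
  rewrite mxE RintegralZl//; first by ring.
  exact: csupp_integrable (csupp_lip0 (rc0 c) (csupp_dbump c i)).
have remE : fr (h + c) - fr c - dot (mollify_grad c) h =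
    Z^-1 * \int[mu]_w (f (X w) * rem w).
  rewrite dotE /mollify -mulrBr -mulrBr; congr (_ * _).
  have i1 := csupp_integrable (csupp_mollify0 E r0 L0 fL (h + c)).
  have i2 := csupp_integrable (csupp_mollify0 E r0 L0 fL c).
  rewrite -RintegralB// -RintegralB//; last exact: (integrableB measurableT i1 i2).
  apply: eq_Rintegral => w _; rewrite /rem /dot.
  rewrite (_ : X w - (h + c) = X w - c - h); last by rewrite opprD addrA addrAC.
  rewrite !mulrBr; congr (_ - _); rewrite mulr_sumr.
  by apply: eq_bigr => i _; ring.
rewrite remE normrM ger0_norm ?Zinv_ge0//.
rewrite -[leRHS]mulrA ler_wpM2l ?Zinv_ge0//.
rewrite (le_trans (csupp_norm_integral B0 (csupp_lip0 B0 srem)))//.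
by rewrite mulrA mulrAC.
Qed.

Lemma mollify_differentiable c : differentiable fr c /\ grad fr c = mollify_grad c.
Proof.
by have [C HC] := mollify_remainder c; exact: differentiable_of_remainder HC.
Qed.

Lemma continuous_row (V : topologicalType) (g : V -> 'rV[R]_n) (x : V) :
  (forall i, {for x, continuous (fun y => g y 0 i)}) -> {for x, continuous g}.
Proof.
move=> gc; apply/cvgrPdist_le => e e0.
have H i : \forall y \near x, `|g x 0 i - g y 0 i| <= e.
  by have /cvgrPdist_le := gc i; exact.
have H' : \forall y \near x, forall i, `|g x 0 i - g y 0 i| <= e.
  exact: filter_forall.
near=> y; have Hy : forall i, `|g x 0 i - g y 0 i| <= e by near: y.
by apply: norm_leP => [|i]; [exact: ltW|rewrite !mxE].
Unshelve. all: by end_near. Qed.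

Lemma mollify_grad_continuous : continuous mollify_grad.
Proof.
move=> c; apply: continuous_row => i.
have [C HC] := dbump_lip (n := n) r0.
pose B := r + 1 + `|c|; have B0 : 0 <= B by rewrite !addr_ge0// ltW.
pose M := Z^-1 * ((`|f 0| + L * B) * C * (2 * B) ^+ n).
have HM h : `|h| <= 1 -> `|mollify_grad (c + h) 0 i - mollify_grad c 0 i| <= M * `|h|.
  move=> h1; pose rem w := dbump r (X w - c - h) 0 i - dbump r (X w - c) 0 i.
  have mrem : measurable_fun setT rem.
    apply: measurable_funB; last exact: measurable_dbump.
    rewrite (_ : (fun w => _) = fun w => dbump r (X w - (c + h)) 0 i).
      exact: measurable_dbump.
    by apply/funext => w; rewrite opprD addrA.
  have srem : csupp (C * `|h|) B rem.
    split=> // w; have [H1 H2] := HC (X w - c) h h1.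
    have remE : rem w = (dbump r (X w - c - h) - dbump r (X w - c)) 0 i.
      by rewrite /rem; move: (dbump _ _) (dbump _ _) => a b; rewrite !mxE.
    rewrite remE; split=> [|/far_center /H2 ->]; last by rewrite mxE.
    exact: le_trans (coord_le_norm _ _) H1.
  have i1 := csupp_integrable (csupp_lip0 (rc0 (c + h)) (csupp_dbump (c + h) i)).
  have i2 := csupp_integrable (csupp_lip0 (rc0 c) (csupp_dbump c i)).
  rewrite !mxE -mulrBr -RintegralB//.
  rewrite (_ : (fun w => _ - _) = fun w => f (X w) * rem w); last first.
    by apply/funext => w; rewrite -mulrBr /rem opprD addrA.
  rewrite normrM ger0_norm ?Zinv_ge0//.
  rewrite -[leRHS]mulrA ler_wpM2l ?Zinv_ge0//.
  rewrite (le_trans (csupp_norm_integral B0 (csupp_lip0 B0 srem)))//.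
  by rewrite mulrA mulrAC.
exact: continuous_of_modulus HM.
Qed.

Lemma mollify_C1 U : C1_on U fr.
Proof.
have gE : grad fr = mollify_grad.
  by apply/funext => c; have [] := mollify_differentiable c.
split=> x _; first by have [] := mollify_differentiable x.
by rewrite gE; exact: mollify_grad_continuous.
Qed.

End MollifierC1.

(** Dominated convergence is about sequences, so derivatives are taken along the increments
    1/(m+1). *)
Lemma derivable_cvg_seq (R : realType) (V : normedModType R) (f : V -> R) (x v : V) :
  derivable f x v ->
  m.+1%:R * (f (m.+1%:R^-1 *: v + x) - f x) @[m --> \oo] --> 'D_v f x.
Proof.
move=> df; have c : (fun m : nat => m.+1%:R^-1 : R) @ \oo --> (0 : R)^'.
  move=> P /=; rewrite /dnbhs/= /within/= => /(cvg_harmonic (R := R)) [N _ NP].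
  by exists N => // m /= Nm; apply: (NP m Nm); rewrite /= invr_eq0.
have := cvg_comp _ _ c df; apply: cvg_trans; apply: near_eq_cvg.
by near=> m => /=; rewrite invrK.
Unshelve. all: by end_near. Qed.

Lemma cvg_sum (R : realType) (T I : Type) (F : set_system T) (FF : Filter F)
    (s : seq I) (u : I -> T -> R) (l : I -> R) :
  (forall i, u i t @[t --> F] --> l i) ->
  \sum_(i <- s) u i t @[t --> F] --> \sum_(i <- s) l i.
Proof. by move=> ul; apply: cvg_big => // x; exact: add_continuous. Qed.

Section MollifierGradient.
Context {R : realType} {n : nat} (E : euclid_measure R n).
Local Notation T := (em_T E).
Local Notation mu := (em_mu E).
Local Notation X := (@em_X _ _ E).
Variable r : R.
Hypothesis r0 : 0 < r.
Variables (f : 'rV[R]_n -> R) (L : R).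
Hypotheses (L0 : 0 <= L) (fL : lip L f).
Local Notation Z := (bump_mass E r).
Local Notation fr := (mollify E r f).

(** The gradient of [f] is never integrated. The averages of the difference quotients [S m] converge
    to [dot e (grad fr c)], while the excess [P m] of [S m] over [a], weighted by the kernel, is
    dominated and tends to 0 almost everywhere. *)
Lemma mollify_grad_le (c e : 'rV[R]_n) (a : R) :
  {ae mu, forall w, `|X w - c| <= r -> dot e (grad f (X w)) <= a} ->
  dot e (grad fr c) <= a.
Proof.
move=> ae_le.
have ae_d : {ae mu, forall w, forall i : 'I_n, derivable f (X w) (delta_mx 0 i)}.
  by apply: filter_forall => i; exact: (lip_derivable_ae E fL).
have [N [mN N0 NP]] : mu.-negligible (~` [set w |
    (`|X w - c| <= r -> dot e (grad f (X w)) <= a) /\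
    forall i : 'I_n, derivable f (X w) (delta_mx 0 i)]).
  exact: (filterI ae_le ae_d).
have good w : ~ N w -> (`|X w - c| <= r -> dot e (grad f (X w)) <= a) /\
    forall i : 'I_n, derivable f (X w) (delta_mx 0 i).
  by move=> nN; apply: contrapT => H; apply: nN; exact: NP.
pose b w := bump r (X w - c).
have sb : csupp (r ^+ 4) (r + `|c|) b by exact: csupp_bump.
pose q m (i : 'I_n) w := f (m.+1%:R^-1 *: delta_mx 0 i + X w) - f (X w).
(* Since [grad] collects partial derivatives, the quotients are taken coordinate by coordinate and
   combined with the weights [e 0 i]. *)
pose S m w := \sum_(i < n) e 0 i * (m.+1%:R * q m i w).
pose P m w := pos_part (S m w * b w - a * b w).
pose A := \sum_(i < n) `|e 0 i| * (L * `|delta_mx 0 i : 'rV[R]_n|).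
have mq m i : measurable_fun setT (q m i).
  apply: measurable_funB; last exact: (measurable_lip (E := E) fL).
  exact: (measurable_lip (E := E) (lip_shift (m.+1%:R^-1 *: delta_mx 0 i) fL)).
have mS m : measurable_fun setT (S m).
  by apply: measurable_sum => i; do 2 apply: measurable_funM => //.
have SA m w : `|S m w| <= A.
  rewrite (le_trans (ler_norm_sum _ _ _))// ler_sum// => i _.
  rewrite !normrM ler_wpM2l// /q ger0_norm//.
  rewrite -ler_pdivlMl// mulrC (le_trans (fL _ _))//.
  by rewrite addrK normrZ ger0_norm ?invr_ge0// mulrA mulrAC.
have A0 : 0 <= A by apply: sumr_ge0 => i _; rewrite !mulr_ge0.
have sSb m : csupp (A * r ^+ 4) (r + `|c|) (fun w => S m w * b w).
  by apply: csuppM sb => // w _; exact: SA.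
have sD m : csupp (A * r ^+ 4 + `|- a| * r ^+ 4) (r + `|c|)
    (fun w => S m w * b w + (- a) * b w) by exact: csuppD (csuppZ _ sb).
have sP m : csupp (A * r ^+ 4 + `|- a| * r ^+ 4) (r + `|c|) (P m).
  split.
    apply: measurable_maxr => //; apply: measurable_funB; first exact: (sSb m).1.
    by apply: measurable_funM => //; exact: sb.1.
  move=> w; have [H1 H2] := (sD m).2 w; rewrite mulNr in H1 H2.
  split=> [|/H2]; last by rewrite /P /pos_part => ->; rewrite maxxx.
  rewrite ger0_norm ?pos_part_ge0// /P /pos_part ge_max.
  by rewrite (le_trans (normr_ge0 _) H1) (le_trans (ler_norm _) H1).
have cP : \int[mu]_w P m w @[m --> \oo] --> 0.
  pose g w := (A + `|a|) * b w.
  have ig : mu.-integrable setT (EFin \o g) by exact: csupp_integrable (csuppZ _ sb).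
  have mD : measurable (setT `\` N) by exact: measurableD.
  have bw0 w : 0 <= b w by exact: bump_ge0.
  have pw w : (setT `\` N) w -> P m w @[m --> \oo] --> 0.
    move=> [_ /good[dle dd]]; have [Xr|rX] := leP `|X w - c| r; last first.
      rewrite (_ : (fun m => P m w) = cst 0); first exact: cvg_cst.
      by apply/funext => m; rewrite /P /b bump_out// !mulr0 subr0 /pos_part maxxx.
    have cS : S m w @[m --> \oo] --> dot e (grad f (X w)).
      apply: cvg_sum => i; apply: cvgM; first exact: cvg_cst.
      by rewrite mxE; apply: derivable_cvg_seq.
    have -> : 0 = pos_part (dot e (grad f (X w)) * b w - a * b w).
      apply/esym/max_idPl; rewrite -mulrBl mulr_le0_ge0// subr_le0; exact: dle.
    have cpos : continuous (@pos_part R).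
      by apply: (@lip_continuous R R 1) => s t; rewrite mul1r pos_part_lip.
    apply: (continuous_cvg _ (cpos _)).
    by apply: cvgB; [apply: cvgM => //; exact: cvg_cst|exact: cvg_cst].
  have mP m : measurable_fun (setT `\` N) (EFin \o P m).
    by apply: measurable_funTS; apply/measurable_EFinP; exact: (sP m).1.
  have gfin w : (setT `\` N) w -> (EFin \o g) w \is a fin_num by [].
  have ig' : mu.-integrable (setT `\` N) (EFin \o g).
    exact: integrableS ig.
  have Pg m w : (setT `\` N) w -> (`|(EFin \o P m) w| <= (EFin \o g) w)%E.
    move=> _; rewrite /= lee_fin ger0_norm ?pos_part_ge0// /P /pos_part ge_max.
    rewrite /g mulr_ge0 ?addr_ge0//= -mulrBl ler_wpM2r//.
    by rewrite lerD ?(le_trans (ler_norm _) (SA m w))// -normrN ler_norm.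
  have pw' w : (setT `\` N) w -> (EFin \o P m) w @[m --> \oo] --> (cst 0%E : T -> \bar R) w.
    by move=> Dw; apply: cvg_EFin; [exact: nearW|exact: pw].
  have := dominated_cvg mD mP pw' gfin ig' Pg.
  rewrite integral0 => /fine_cvg; apply: cvg_trans; apply: near_eq_cvg.
  near=> m; rewrite /Rintegral /=; congr fine; apply/esym.
  apply: negligible_integral => //.
  exact: csupp_integrable (sP m).
have leP m : \int[mu]_w (S m w * b w) - a * Z <= \int[mu]_w P m w.
  have -> : a * Z = \int[mu]_w (a * b w).
    by rewrite RintegralZl ?integral_bump//; exact: csupp_integrable sb.
  rewrite -RintegralB//; last 2 first.
  - exact: csupp_integrable (sSb m).
  - exact: csupp_integrable (csuppZ a sb).
  apply: le_Rintegral => //; last by move=> w _; rewrite le_max lexx orbT.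
    have := csupp_integrable (sD m); apply: eq_integrable => // w _ /=.
    by rewrite mulNr.
  exact: csupp_integrable (sP m).
have SE m : \int[mu]_w (S m w * b w) = Z * \sum_(i < n) e 0 i *
   (m.+1%:R * (fr (m.+1%:R^-1 *: delta_mx 0 i + c) - fr c)).
  pose h i : 'rV[R]_n := m.+1%:R^-1 *: delta_mx 0 i.
  have i1 i := csupp_integrable (csupp_mollify E r0 L0 fL (h i) c).
  have i2 := csupp_integrable (csupp_mollify0 E r0 L0 fL c).
  have i3 i : mu.-integrable setT (EFin \o (fun w => f (X w + h i) * b w - f (X w) * b w)).
    exact: (integrableB measurableT (i1 i) i2).
  pose F i w := e 0 i * m.+1%:R * (f (X w + h i) * b w - f (X w) * b w).
  have iF i : mu.-integrable setT (EFin \o F i).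
    have := integrableZl measurableT (e 0 i * m.+1%:R) (i3 i).
    by apply: eq_integrable => // w _ /=; rewrite EFinM.
  rewrite (_ : (fun w => S m w * b w) = fun w => \sum_(i < n) F i w); last first.
    apply/funext => w; rewrite mulr_suml; apply: eq_bigr => i _.
    by rewrite /F /q (addrC (_ *: _)); ring.
  rewrite (Rintegral_sum (index_enum 'I_n) iF).2 mulr_sumr; apply: eq_bigr => i _.
  rewrite RintegralZl// RintegralB//.
  rewrite (addrC _ c) (mollify_shift E r0 L0 fL) /mollify.
  have Z0 := bump_mass_gt0 E r0.
  by field; rewrite gt_eqF.
have [df _] := mollify_differentiable E r0 L0 fL c.
have cS : \int[mu]_w (S m w * b w) - a * Z @[m --> \oo] -->
    Z * dot e (grad fr c) - a * Z.
  apply: cvgB; last exact: cvg_cst.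
  under eq_fun do rewrite SE.
  apply: cvgM; first exact: cvg_cst.
  apply: cvg_sum => i; apply: cvgM; first exact: cvg_cst.
  rewrite mxE; apply: derivable_cvg_seq; exact: diff_derivable.
have : Z * dot e (grad fr c) - a * Z <= 0.
  by apply: (ler_cvg_to cS cP); exact: nearW.
by rewrite subr_le0 mulrC ler_pM2r ?bump_mass_gt0.
Unshelve. all: by end_near. Qed.

End MollifierGradient.

(** * Null sets: coverings by boxes and the product measure *)

Section OuterMeasure.
Context {R : realType} {n : nat}.

(* In dimension 0 every box has volume 1, the empty product. *)
Lemma lebesgue_outer0 : (0 < n)%N -> @lebesgue_outer R n set0 = 0%E.
Proof.
move=> n0; apply/eqP; rewrite eq_le; apply/andP; split.
  apply: ereal_inf_lbound; exists (fun=> 0), (fun=> 0); split=> [|//|].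
    by move=> k i; rewrite lexx.
  rewrite eseries0// => k _ _; congr EFin.
  by rewrite (bigD1 (Ordinal n0))//= subrr mul0r.
apply: le_ereal_inf_tmp => _ [a [b [ab _ ->]]].
apply: nneseries_ge0 => k _ _; rewrite lee_fin.
by apply: prodr_ge0 => i _; rewrite subr_ge0.
Qed.

(** Negligibility asks for a measurable null set around [A]: it is the intersection of coverings by
    boxes with total volume below 1/(k+1). *)
Lemma outer_null_negligible (E : euclid_measure R n) (A : set 'rV[R]_n) :
  lebesgue_outer A = 0%E -> (em_mu E).-negligible (@em_X _ _ E @^-1` A).
Proof.
move=> A0; set X := @em_X _ _ E; set mu := em_mu E.
have cover k : exists C, [/\ measurable C, X @^-1` A `<=` C &
    (mu C <= (k.+1%:R^-1)%:E)%E].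
  have : (lebesgue_outer A < (k.+1%:R^-1)%:E)%E by rewrite A0 lte_fin invr_gt0.
  move=> /ereal_inf_lt[_ [a [b [ab Aab ->]]] sk].
  pose C j := X @^-1` box (a j) (b j).
  have mC j : measurable (C j) by apply: measurable_box; exact: em_meas.
  exists (\bigcup_j C j); split.
  - exact: bigcupT_measurable.
  - by move=> w /Aab [j _ abj]; exists j.
  - apply: (le_trans (generalized_Boole_inequality mu mC _)).
      exact: bigcupT_measurable.
    apply: ltW; apply: le_lt_trans sk.
    apply: lee_nneseries => [j _ _|j _]; first exact: measure_ge0.
    by move/eqP: (em_box E (ab j)); rewrite eq_le => /andP[].
have /choice[C CP] := cover.
exists (\bigcap_k C k); split.
- by apply: bigcapT_measurable => k; have [] := CP k.
- apply/eqP; rewrite eq_le measure_ge0 andbT.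
  apply/lee_addgt0Pr => e e0; rewrite add0e.
  have [k _ /(_ k (leqnn k)) ke] := near_infty_natSinv_lt (PosNum e0).
  have [mC _ Ck] := CP k.
  apply: (@le_trans _ _ (mu (C k))).
    apply: le_measure; rewrite ?inE//; last by move=> w; exact.
    by apply: bigcapT_measurable => j; have [] := CP j.
  by rewrite (le_trans Ck)// lee_fin ltW.
- by move=> w Aw k _; have [_ + _] := CP k; exact.
Qed.

Lemma ess_sup_on_le (V : set 'rV[R]_n) f (M : \bar R) : (0 < n)%N ->
  (forall x, V x -> (f x <= M)%E) -> (ess_sup_on V f <= M)%E.
Proof.
move=> n0 fM; apply: ereal_inf_lbound => /=.
rewrite (_ : [set _ | _] = set0) ?lebesgue_outer0//.
by apply/seteqP; split=> x // -[/fM].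
Qed.

Lemma ess_sup_on_negligible (E : euclid_measure R n) (V : set 'rV[R]_n) f (M : \bar R) :
  (ess_sup_on V f < M)%E ->
  (em_mu E).-negligible (@em_X _ _ E @^-1` [set x | V x /\ ~ (f x <= M)%E]).
Proof.
move=> /ereal_inf_lt[m /= m0 mM].
apply: negligibleS (outer_null_negligible E m0) => w /= [Vx fM]; split=> // fm.
by apply: fM; rewrite (le_trans fm)// ltW.
Qed.

End OuterMeasure.

(** * Increments of viscosity subsolutions *)

Section Separation.
Context {R : realType} {n : nat}.
Implicit Types (p q e : 'rV[R]_n).

Lemma sqr_dotB p q : dot (p - q) (p - q) = dot p p - 2 * dot p q + dot q q.
Proof. by rewrite dotDl !dotDr !dotNl !dotNr (dotC q); ring. Qed.

Lemma dot_self_continuous p : continuous (fun q => dot (p - q) (p - q)).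
Proof.
move=> q; apply: (@continuous_of_modulus _ _ _ _ (2 * n%:R * `|p - q| + n%:R)) => h h1.
have -> : dot (p - (q + h)) (p - (q + h)) - dot (p - q) (p - q) =
    dot h h - 2 * dot (p - q) h.
  by rewrite opprD addrA sqr_dotB; ring.
rewrite (le_trans (ler_normB _ _))// normrM (ger0_norm (ler0n _ 2)).
have := norm_dot_le h h; have := norm_dot_le (p - q) h.
have : n%:R * `|h| * `|h| <= n%:R * 1 * `|h| by rewrite ler_wpM2r// ler_wpM2l.
lra.
Qed.

Lemma sublevel_separation (h : 'rV[R]_n -> R) (b M : R) p :
  (0 < n)%N -> continuous h ->
  (forall t q q', 0 <= t <= 1 ->
    h (t *: q + (1 - t) *: q') <= t * h q + (1 - t) * h q') ->
  (forall q, h q <= b -> `|q| <= M) ->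
  b < h p ->
  exists e a, [/\ e != 0, forall q, h q <= b -> dot e q <= a & a < dot e p].
Proof.
move=> n0 hc hconv hM bp.
(* An empty sublevel set lies in every half space; any nonzero direction will do, and there is one
   because [0 < n]. *)
have [[q0 q0b]|Cempty] := pselect (exists q, h q <= b); last first.
  exists (delta_mx 0 (Ordinal n0)), (dot (delta_mx 0 (Ordinal n0)) p - 1); split.
  - apply/eqP => /rowP /(_ (Ordinal n0)) /eqP; rewrite !mxE !eqxx.
    by rewrite oner_eq0.
  - by move=> q qb; exfalso; apply: Cempty; exists q.
  - by rewrite ltrBlDr ltrDl.
pose C := [set q | h q <= b].
have Cc : compact C.
  apply: bounded_closed_compact.
    exists M; split; first by rewrite num_real.
    by move=> x Mx q /hM /le_trans; apply; exact: ltW.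
  rewrite (_ : C = h @^-1` [set t | t <= b])//.
  by apply: closed_comp => [x _|]; [exact: hc|exact: closed_le].
have [||q /set_mem Cq qmin] := @EVT_min_rV R n (fun q => dot (p - q) (p - q)) C _ Cc.
  by exists q0.
  by apply: continuous_subspaceT; exact: dot_self_continuous.
(* [q] is the point of the sublevel set nearest to [p]. *)
exists (p - q), (dot (p - q) q).
have pq : p - q != 0.
  by apply: contraTneq bp => /subr0_eq ->; rewrite -leNgt.
split=> //; last by rewrite -subr_gt0 -dotNr -dotDr dot_gt0.
move=> q' Cq'; rewrite -subr_le0 -dotNr -dotDr.
apply/ler_addgt0Pr => d d0; rewrite add0r.
pose Q := dot (q' - q) (q' - q).
have Q0 : 0 <= Q by exact: dot_ge0.
(* Comparing [q] with the point at parameter [t] towards [q'] gives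
   [2 * dot (p - q) (q' - q) <= t * Q]; this [t] makes the right-hand side at most [d]. *)
pose t := Num.min 1 (d / (Q + 1)).
have t0 : 0 < t by rewrite lt_min ltr01 divr_gt0// ltr_wpDl.
have t1 : t <= 1 by rewrite ge_min lexx.
have tQ : t * Q <= d.
  apply: (@le_trans _ _ (d / (Q + 1) * (Q + 1))); last by rewrite divfK// gt_eqF// ltr_wpDl.
  by apply: ler_pM => //; [exact: ltW|rewrite ge_min lexx orbT|rewrite lerDl].
have Ct : C (t *: q' + (1 - t) *: q).
  rewrite /C/= (le_trans (hconv _ _ _ _))//; first by rewrite ltW.
  have : t * h q' <= t * b by rewrite ler_pM2l.
  have : (1 - t) * h q <= (1 - t) * b by rewrite ler_wpM2l// subr_ge0.
  lra.
have := qmin _ (mem_set Ct).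
have -> : p - (t *: q' + (1 - t) *: q) = (p - q) - t *: (q' - q).
  by rewrite scalerBr scalerBl scale1r; apply/rowP => i; rewrite !mxE; ring.
rewrite (sqr_dotB (p - q)) dotZr dotZl dotZr -/Q => H.
have : t * (2 * dot (p - q) (q' - q)) <= t * (t * Q) by lra.
rewrite ler_pM2l// => H'; lra.
Qed.

End Separation.

Section Transport.
Context {R : realType} {n : nat}.
Implicit Types (p q e x y z : 'rV[R]_n).

Lemma sqr_dotD p q : dot (p + q) (p + q) = dot p p + 2 * dot p q + dot q q.
Proof. by rewrite dotDl !dotDr (dotC q); ring. Qed.

(* The test function for the bound on the increments of a subsolution along the
   segment from [y] to [y + T *: e]: it grows with slope at least [k] in the
   direction [e], and its quadratic terms keep the maximum of the subsolution
   minus the barrier inside a cylinder around the segment. *)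
Section Barrier.
Variables (y e : 'rV[R]_n) (k T B C : R).
Hypothesis e0 : e != 0.

Definition axial z : R := dot e (z - y) / dot e e.

Definition radial z : 'rV[R]_n := (z - y) - axial z *: e.

Definition barrier z : R :=
  k * axial z + B * pos_part (axial z - T) ^+ 2 + C * dot (radial z) (radial z).

Definition dbarrier z : 'rV[R]_n :=
  ((k + 2 * B * pos_part (axial z - T)) / dot e e) *: e + (2 * C) *: radial z.

Let ee : dot e e != 0. Proof. by rewrite dot_eq0. Qed.

Lemma dot_radial z : dot e (radial z) = 0.
Proof. by rewrite /radial dotDr dotNr dotZr /axial divfK ?ee// subrr. Qed.

(** The radial term is orthogonal to [e], so for [B >= 0] the slope along [e] is at least [k]
    whatever [C] is: the penalty can be made as strong as needed. *)
Lemma dot_dbarrier z : dot e (dbarrier z) = k + 2 * B * pos_part (axial z - T).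
Proof. by rewrite dotDr !dotZr dot_radial mulr0 addr0 divfK ?ee. Qed.

Lemma axialD z h : axial (h + z) = dot e h / dot e e + axial z.
Proof. by rewrite /axial -(addrA h) (dotDr h) mulrDl. Qed.

Lemma axial_lip : lip (n%:R * `|e| / dot e e) axial.
Proof.
move=> u v; rewrite /axial -mulrBl -dotNr -dotDr opprB addrA subrK normrM.
rewrite [X in _ * X]ger0_norm ?invr_ge0 ?dot_ge0//.
rewrite [leRHS]mulrAC ler_wpM2r ?invr_ge0 ?dot_ge0//.
exact: norm_dot_le.
Qed.

Lemma dbarrier_continuous : continuous dbarrier.
Proof.
move=> z.
have ca : axial x @[x --> z] --> axial z by exact: (lip_continuous axial_lip).
have c0 : pos_part (axial x - T) @[x --> z] --> pos_part (axial z - T).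
  apply: (@lip_continuous _ _ (n%:R * `|e| / dot e e) (fun x => pos_part (axial x - T))) => u v.
  rewrite (le_trans (pos_part_lip _ _))// opprB addrA subrK.
  exact: axial_lip.
have c1 : (k + 2 * B * pos_part (axial x - T)) / dot e e @[x --> z] -->
    (k + 2 * B * pos_part (axial z - T)) / dot e e.
  exact: (cvgM (cvgD (cvg_cst _) (cvgM (cvg_cst _) c0)) (cvg_cst _)).
have c2 : radial x @[x --> z] --> radial z.
  exact: (cvgB (cvgB cvg_id (cvg_cst _)) (cvgZ ca (cvg_cst _))).
exact: (cvgD (cvgZ c1 (cvg_cst _)) (cvgZ (cvg_cst _) c2)).
Qed.

Lemma barrier_differentiable z : differentiable barrier z /\ grad barrier z = dbarrier z.
Proof.
apply: (@differentiable_of_remainder _ _ _ _ _ ((`|B| / dot e e + `|C|) * n%:R)) => h _.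
(* Orthogonal splitting of the increment: [s] enters the axial terms only and [w] the radial term
   only, and both are controlled by [dot h h]. *)
pose s := dot e h / dot e e; pose w := h - s *: e.
have radialD : radial (h + z) = radial z + w.
  by rewrite /radial axialD -/s /w; apply/rowP => i; rewrite !mxE; ring.
have hE : dot h h = dot w w + s ^+ 2 * dot e e.
  have ew : dot e w = 0 by rewrite /w dotDr dotNr dotZr /s divfK ?ee// subrr.
  rewrite -{1 2}(subrK (s *: e) h) -/w sqr_dotD !dotZl !dotZr (dotC w) ew; ring.
have -> : barrier (h + z) - barrier z - dot (dbarrier z) h =
    B * (pos_part (axial (h + z) - T) ^+ 2 - pos_part (axial z - T) ^+ 2
       - 2 * pos_part (axial z - T) * ((axial (h + z) - T) - (axial z - T)))
    + C * dot w w.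
  have rh : dot (radial z) h = dot (radial z) w.
    by rewrite /w dotDr dotNr dotZr (dotC _ e) dot_radial mulr0 subr0.
  rewrite /barrier /dbarrier radialD (dotDl _ _ h) !dotZl rh axialD -/s.
  rewrite sqr_dotD; move: (dot (radial z) w) (dot w w) => rw ww.
  have -> : dot e h = s * dot e e by rewrite /s divfK ?ee.
  by field; exact: ee.
rewrite (le_trans (ler_normD _ _))// !normrM.
rewrite (ger0_norm (dot_ge0 w)).
have H1 := pos_part_remainder (axial (h + z) - T) (axial z - T).
have sE : (axial (h + z) - T) - (axial z - T) = s by rewrite axialD -/s; ring.
rewrite sE in H1 *.
have hn : dot h h <= n%:R * `|h| ^+ 2.
  by rewrite (le_trans (ler_norm _))// expr2 mulrA norm_dot_le.
have E0 : 0 < dot e e by rewrite dot_gt0.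
have s2 : s ^+ 2 <= dot h h / dot e e.
  by rewrite ler_pdivlMr// hE lerDr dot_ge0.
have w2 : dot w w <= dot h h by rewrite hE lerDl mulr_ge0 ?sqr_ge0// ltW.
apply: (@le_trans _ _ ((`|B| / dot e e + `|C|) * dot h h)); last first.
  rewrite -[leRHS]mulrA ler_wpM2l// addr_ge0// mulr_ge0// invr_ge0 ltW//.
rewrite [leRHS]mulrDl; apply: lerD; last by rewrite ler_wpM2l.
rewrite -[leRHS]mulrA ler_wpM2l// [leRHS]mulrC.
exact: le_trans H1 s2.
Qed.

Lemma barrier_C1 U : C1_on U barrier.
Proof.
have gE : grad barrier = dbarrier.
  by apply/funext => z; have [] := barrier_differentiable z.
split=> z _; first by have [] := barrier_differentiable z.
by rewrite gE; exact: dbarrier_continuous.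
Qed.

End Barrier.

Lemma continuous_bounded_ball (f : 'rV[R]_n -> R) x (s : R) : continuous f ->
  exists2 M, 0 <= M & forall z, `|z - x| <= s -> `|f z| <= M.
Proof.
move=> fc; pose K := [set z | `|z - x| <= s].
have cK : compact K.
  apply: bounded_closed_compact.
    exists (s + `|x|); split; first by rewrite num_real.
    move=> M sM z /= zs; rewrite -(subrK x z) (le_trans (ler_normD _ _))//.
    by rewrite (le_trans _ (ltW sM))// lerD2r.
  rewrite (_ : K = (fun z => `|z - x|) @^-1` [set t | t <= s])//.
  apply: closed_comp; last exact: closed_le.
  move=> z _; apply: (@lip_continuous _ _ 1 (fun z => `|z - x|)) => u v.
  by rewrite mul1r (le_trans (ler_dist_dist _ _))// opprB addrA subrK.
have [[z0 Kz0]|K0] := pselect (K !=set0); last first.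
  by exists 0 => // z Kz; exfalso; apply: K0; exists z.
have [||c _ cmax] := @EVT_max_rV R n (fun z => `|f z|) K _ cK; first by exists z0.
  by apply: continuous_subspaceT => z; exact: (cvg_norm (fc z)).
by exists `|f c| => // z Kz; apply: cmax; exact: mem_set.
Qed.

(** Were the increment larger, [D] minus a barrier of slope [k > a] would have an interior maximum
    in the cylinder, where the subsolution property forces the slope to be at most [a]. *)
Lemma visc_transport (O : set 'rV[R]_n) F (mu : R) (D : 'rV[R]_n -> R)
    x0 (s : R) e (a : R) :
  continuous D -> visc_subsolution O F mu D -> 0 < s ->
  (forall z, `|z - x0| <= s -> O z) -> e != 0 ->
  (forall z p, `|z - x0| <= s -> F p z <= mu -> dot e p <= a) ->
  forall y (T : R), 4 * `|y - x0| <= s -> 0 <= T -> 4 * (T * `|e|) <= s ->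
  D (y + T *: e) - D y <= a * T.
Proof.
move=> cD subD s0 OB e0 Fa y T ys; rewrite le_eqVlt => /predU1P[<-|T0] Ts.
  by rewrite scale0r addr0 subrr mulr0.
rewrite leNgt; apply/negP => aT.
pose kap := D (y + T *: e) - D y - a * T.
have kap0 : 0 < kap by rewrite subr_gt0.
(* A quarter of the excess [kap] pays for raising the slope from [a] to [k] over the length [T],
   another quarter for the variation of [D] near [y]; the rest keeps the maximum off the initial
   face. *)
pose k := a + kap / (4 * T).
have kT : k * T = a * T + kap / 4 by rewrite /k; field; rewrite gt_eqF.
have ka : a < k by rewrite ltrDl divr_gt0// mulr_gt0.
have [Bd Bd0 DB] := continuous_bounded_ball x0 s cD.
have [d d0 Dd] : exists2 d, 0 < d & forall v, `|v| <= d -> D (y + v) <= D y + kap / 4.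
  have /cvgrPdist_le/(_ (kap / 4)) := cD y.
  move=> /(_ (divr_gt0 kap0 (ltr0n _ 4)))/nbhs_normP[d /= d0 dP].
  exists (d / 2) => [|v vd]; first by rewrite divr_gt0.
  have := dP (y + v); rewrite /= opprD addNKr normrN.
  have vd' : `|v| < d by rewrite (le_lt_trans vd)// ltr_pdivrMr// ltr_pMr// ltr1n.
  by move=> /(_ vd'); rewrite ler_norml => /andP[? ?]; lra.
pose h := s / 4; have h0 : 0 < h by rewrite divr_gt0.
(* No maximum point can pay a penalty of size [M], which outweighs the variation of [D] and of the
   linear term. [B] bars the far end; in [C] one term bars the side wall, and the other the part of
   the initial face farther than [d] from [y]. *)
pose M := 2 * Bd + `|k| * (2 * T) + 1.
have M0 : 0 < M by rewrite ltr_wpDl// addr_ge0// !mulr_ge0// ltW.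
pose C := M / d ^+ 2 + M / h ^+ 2.
pose B := M / T ^+ 2.
have d2 : 0 < d ^+ 2 by rewrite exprn_gt0.
have h2 : 0 < h ^+ 2 by rewrite exprn_gt0.
have C0 : 0 < C by rewrite addr_gt0// divr_gt0.
have B0 : 0 < B by rewrite divr_gt0// exprn_gt0.
have Cd : M <= C * d ^+ 2.
  by rewrite mulrDl divfK ?gt_eqF// lerDl mulr_ge0 ?divr_ge0// ltW.
have Ch : M <= C * h ^+ 2.
  by rewrite mulrDl addrC divfK ?gt_eqF// lerDl mulr_ge0 ?divr_ge0// ltW.
have BT : B * T ^+ 2 = M by rewrite divfK// gt_eqF// exprn_gt0.
pose phi := barrier y e k T B C.
pose ax := axial y e.
pose rq z := dot (radial y e z) (radial y e z).
have phiE z : phi z = k * ax z + B * pos_part (ax z - T) ^+ 2 + C * rq z by [].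
have cax : continuous ax by exact: lip_continuous (axial_lip y e).
have crq : continuous rq.
  move=> z; have -> : rq = barrier y e 0 0 0 1.
    by apply/funext => z'; rewrite /barrier !mul0r mul1r !add0r.
  by apply: differentiable_continuous; have [] := barrier_differentiable y 0 0 0 1 e0 z.
(* The cylinder has length [2 * T] and radius [h]. It fits in the ball of radius [s]: [s / 4] for
   the distance from [x0] to [y], [s / 2] for the length and [s / 4] for the radius. *)
pose K := [set z | 0 <= ax z <= 2 * T /\ rq z <= h ^+ 2].
have zE z : z = y + ax z *: e + radial y e z by rewrite /radial -/ax; apply/rowP => i; rewrite !mxE; ring.
have KB z : K z -> `|z - x0| <= s.
  move=> [/andP[az1 az2] rz].
  have -> : z - x0 = (y - x0) + ax z *: e + radial y e z.
    by rewrite /radial -/ax; apply/rowP => i; rewrite !mxE; ring.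
  have rh : `|radial y e z| <= h.
    rewrite -ler_sqr ?nnegrE ?normr_ge0 ?(ltW h0)//.
    exact: le_trans (sqr_norm_le_dot _) rz.
  have ae : `|ax z *: e| <= 2 * (T * `|e|).
    by rewrite normrZ ger0_norm// mulrA ler_wpM2r.
  rewrite (le_trans (ler_normD _ _))//.
  have := ler_normD (y - x0) (ax z *: e).
  rewrite /h in rh; lra.
have cK : compact K.
  apply: bounded_closed_compact.
    exists (s + `|x0|); split; first by rewrite num_real.
    move=> N sN z /KB zs /=; rewrite -(subrK x0 z) (le_trans (ler_normD _ _))//.
    by rewrite (le_trans _ (ltW sN))// lerD2r.
  have -> : K = (ax @^-1` [set t | 0 <= t]) `&` (ax @^-1` [set t | t <= 2 * T]) `&`
      (rq @^-1` [set t | t <= h ^+ 2]).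
    apply/seteqP; split => z /=; first by move=> [/andP[]].
    by move=> [[? ?] ?]; split=> //; apply/andP.
  apply: closedI; first apply: closedI.
  - by apply: closed_comp => [z _|]; [exact: cax|exact: closed_ge].
  - by apply: closed_comp => [z _|]; [exact: cax|exact: closed_le].
  - by apply: closed_comp => [z _|]; [exact: crq|exact: closed_le].
pose z1 := y + T *: e.
have ee : dot e e != 0 by rewrite dot_eq0.
have ax1 : ax z1 = T by rewrite /ax /axial /z1 addrAC subrr add0r dotZr mulfK.
have rq1 : rq z1 = 0.
  have z1y : z1 - y = T *: e by rewrite /z1 addrAC subrr add0r.
  by rewrite /rq /radial -/ax ax1 z1y subrr dot0l.
have Kz1 : K z1 by rewrite /K /= ax1 rq1 (ltW h2) (ltW T0)/=; split=> //; lra.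
have phic : continuous phi.
  by move=> z; apply: differentiable_continuous; have [] := barrier_differentiable y k T B C e0 z.
have [||z /set_mem Kz zmax] := @EVT_max_rV R n (fun z => D z - phi z) K _ cK.
  by exists z1.
  by apply: continuous_subspaceT => z; exact: (cvgB (cD z) (phic z)).
have val1 : D y + kap * (3 / 4) <= D z - phi z.
  apply: le_trans (zmax _ (mem_set Kz1)).
  rewrite phiE ax1 rq1 subrr /pos_part maxxx expr0n !mulr0 !addr0 kT.
  rewrite /kap -/z1; lra.
have [/andP[az1 az2] rz] := Kz.
have Dz := DB _ (KB _ Kz).
have Dy : `|D y| <= Bd by apply: DB; have := normr_ge0 (y - x0); lra.
have kax : - (`|k| * (2 * T)) <= k * ax z.
  rewrite lerNl -mulNr (le_trans (ler_norm _))// normrM normrN ler_wpM2l//.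
  by rewrite ger0_norm.
have B1 : 0 <= B * pos_part (ax z - T) ^+ 2 by rewrite mulr_ge0 ?sqr_ge0// ltW.
have C1 : 0 <= C * rq z by rewrite mulr_ge0 ?dot_ge0// ltW.
move: Dz Dy; rewrite !ler_norml => /andP[Dz1 Dz2] /andP[Dy1 Dy2].
have low : phi z < M - `|k| * (2 * T).
  rewrite ltNge; apply/negP => Hphi.
  by move: val1; rewrite /M in Hphi *; lra.
have az_gt0 : 0 < ax z.
  rewrite lt_neqAle az1 andbT; apply/eqP => az0.
  have zr : z = y + radial y e z by rewrite {1}(zE z) -az0 scale0r addr0.
  have [rd|dr] := leP `|radial y e z| d.
    have := Dd _ rd; rewrite -zr => H.
    have : 0 <= phi z by rewrite phiE -{1}az0 mulr0 add0r addr_ge0.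
    lra.
  have : d ^+ 2 <= rq z.
    apply: le_trans (sqr_norm_le_dot _).
    by rewrite ler_sqr ?nnegrE ?(ltW d0) ?normr_ge0// ltW.
  rewrite -(ler_pM2l C0) => H; move: low; rewrite phiE -{1}az0 mulr0.
  have := mulr_ge0 (normr_ge0 k) (ltW T0); lra.
have az_lt : ax z < 2 * T.
  rewrite lt_neqAle az2 andbT; apply/eqP => az0.
  move: low; rewrite phiE => low.
  have : pos_part (ax z - T) = T.
    rewrite az0 /pos_part (_ : 2 * T - T = T); last by ring.
    exact/max_idPr/ltW.
  move=> pE; rewrite pE BT in low; lra.
have rz_lt : rq z < h ^+ 2.
  rewrite lt_neqAle rz andbT; apply/eqP => rz0.
  by move: low; rewrite phiE rz0; lra.
have nearK : \forall w \near z, K w.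
  near=> w; split; first (apply/andP; split).
  - by apply: ltW; near: w; exact: (cvgr_gt _ (cax z)).
  - by apply: ltW; near: w; exact: (cvgr_lt _ (cax z)).
  - by apply: ltW; near: w; exact: (cvgr_lt _ (crq z)).
have := subD phi z (barrier_C1 y k T B C e0 O) (OB _ (KB _ Kz)).
have [_ ->] := barrier_differentiable y k T B C e0 z.
move=> /(_ _)/(Fa _ _ (KB _ Kz)); rewrite dot_dbarrier// => H.
have : k + 2 * B * pos_part (axial y e z - T) <= a.
  apply: H; apply: filterS nearK => w Kw; exact: zmax (mem_set Kw).
have : 0 <= 2 * B * pos_part (axial y e z - T).
  by apply: mulr_ge0; [apply: mulr_ge0 => //; exact: ltW|exact: pos_part_ge0].
lra.
Unshelve. all: by end_near. Qed.

End Transport.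

(** * Compactness: margins, Lipschitz constants and Lipschitz extension *)

Section CompactSets.
Context {R : realType} {V : normedModType R}.
Implicit Types (K O : set V) (f : V -> R).

Lemma compact_open_margin K O : compact K -> open O -> K `<=` O ->
  exists2 s : R, 0 < s & forall x z, K x -> `|z - x| <= s -> O z.
Proof.
move=> cK oO KO.
have [s [sP s0]] : exists s : R, K `<=` (fun x => forall z, `|z - x| <= s -> O z) /\ 0 < s.
  apply: (@filter_ex _ (at_right (0 : R))).
  apply: filterI; last exact: nbhs_right_gt.
  have cov := (compact_near_coveringP K).1 cK R (at_right (0 : R)) (fun s x => forall z, `|z - x| <= s -> O z) _.
  apply: cov => x Kx.
  have /nbhs_normP[e /= e0 eO] : nbhs x O by apply: open_nbhs_nbhs; split=> //; exact: KO.
  exists ([set y | `|x - y| < e / 2], [set s | s < e / 2]).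
    split => /=; last by apply: nbhs_right_lt; rewrite divr_gt0.
    by apply/nbhs_normP; exists (e / 2) => //=; rewrite divr_gt0.
  move=> [y s] /= [xy se] z zs; apply: eO => /=.
  have := ler_distD y x z; rewrite (distrC y z); lra.
by exists s => // x z /sP; exact.
Qed.

Definition lip_near f x := exists s L : R, 0 < s /\
  forall y z, `|y - x| <= s -> `|z - x| <= s -> `|f y - f z| <= L * `|y - z|.

Lemma lip_near_continuous f x : lip_near f x -> {for x, continuous f}.
Proof.
move=> [s [L [s0 fL]]]; apply/cvgrPdist_le => e e0.
have M0 : 0 < `|L| + 1 by rewrite ltr_wpDl.
apply/nbhs_normP; exists (Num.min s (e / (`|L| + 1))) => /=.
  by rewrite lt_min s0 divr_gt0.
move=> y /=; rewrite lt_min => /andP[/ltW ys /ltW ye].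
rewrite (le_trans (fL _ _ _ _))//; first by rewrite subrr normr0 ltW.
  by rewrite distrC.
rewrite (@le_trans _ _ ((`|L| + 1) * `|x - y|))//.
  by rewrite ler_wpM2r// (le_trans (ler_norm _))// lerDl.
by rewrite mulrC -ler_pdivlMr.
Qed.

(** [K] may fail to be convex, so local constants cannot be chained along segments: close pairs use
    a local constant, pairs at distance at least [s / 2] the bound on [f]. *)
Lemma compact_lip f K : compact K -> (forall x, K x -> lip_near f x) ->
  exists2 L : R, 0 <= L &
    forall x y, K x -> K y -> `|f x - f y| <= L * `|x - y|.
Proof.
move=> cK fK.
have [B BP] : exists B : R, K `<=` (fun x => `|f x| <= B).
  apply: (@filter_ex _ (pinfty_nbhs R)).
  have cov := (compact_near_coveringP K).1 cK R (pinfty_nbhs R) (fun B x => `|f x| <= B) _.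
  apply: cov => x Kx.
  have [s [L [s0 fL]]] := fK x Kx.
  exists ([set y | `|x - y| < s], [set B | `|f x| + `|L| * s < B]).
    split => /=; last by apply: nbhs_pinfty_gt; rewrite num_real.
    by apply/nbhs_normP; exists s.
  move=> [y B] /= [/ltW xy BL].
  have := fL y x; rewrite subrr normr0 distrC => /(_ xy (ltW s0)) H.
  have : L * `|y - x| <= `|L| * s.
    by rewrite distrC (le_trans (ler_norm _))// normrM normr_id ler_wpM2l.
  have := ler_normD (f y - f x) (f x); rewrite subrK distrC in H *; lra.
have [L [LP L0]] : exists L : R, K `<=`
    (fun x => forall y, K y -> `|f x - f y| <= L * `|x - y|) /\ 0 < L.
  apply: (@filter_ex _ (pinfty_nbhs R)).
  apply: filterI; last by apply: nbhs_pinfty_gt; rewrite num_real.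
  have cov := (compact_near_coveringP K).1 cK R (pinfty_nbhs R) (fun L x => forall y, K y -> `|f x - f y| <= L * `|x - y|) _.
  apply: cov => x Kx.
  have [s [L [s0 fL]]] := fK x Kx.
  pose B' := `|f x| + `|L| * s.
  exists ([set y | `|x - y| < s / 2],
    [set M | Num.max L ((B' + B) / (s / 2)) < M]).
    split => /=; last by apply: nbhs_pinfty_gt; rewrite num_real.
    by apply/nbhs_normP; exists (s / 2) => //=; rewrite divr_gt0.
  move=> [y M] /= [/ltW xy]; rewrite gt_max => /andP[LM BM] z Kz.
  have ys : `|y - x| <= s by rewrite distrC; lra.
  have [zs|sz] := leP `|z - x| s.
    by rewrite (le_trans (fL _ _ ys zs))// ler_wpM2r// ltW.
  have yz : s / 2 <= `|y - z|.
    have := ler_distD y x z; rewrite (distrC z x) in sz; lra.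
  have fy : `|f y| <= B'.
    have := fL y x ys; rewrite subrr normr0 => /(_ (ltW s0)) H.
    have : L * `|y - x| <= `|L| * s.
      by rewrite (le_trans (ler_norm _))// normrM normr_id ler_wpM2l.
    have := ler_normD (f y - f x) (f x); rewrite subrK /B'; lra.
  have s20 : 0 < s / 2 by rewrite divr_gt0.
  have M0 : 0 <= M.
    apply: ltW; apply: le_lt_trans BM; rewrite divr_ge0 ?(ltW s20)// addr_ge0 ?(le_trans _ (BP _ Kz))//.
    by rewrite (le_trans _ fy).
  rewrite (le_trans (ler_normB _ _))// (@le_trans _ _ (B' + B))//.
    by rewrite lerD// BP.
  rewrite (@le_trans _ _ (M * (s / 2)))//; last by rewrite ler_wpM2l.
  by rewrite -ler_pdivrMr// ltW.
exists L; first exact: ltW.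
by move=> x y Kx; exact: LP.
Qed.

(** Mollification integrates a globally Lipschitz function, whereas [u] and [D] come with Lipschitz
    bounds on compact sets. The extension is the infimum of the cones of slope [L] over the points
    of [K]. *)
Lemma mcshane f K (L : R) : K !=set0 -> 0 <= L ->
  (forall x y, K x -> K y -> `|f x - f y| <= L * `|x - y|) ->
  exists2 g : V -> R, lip L g & forall x, K x -> g x = f x.
Proof.
move=> [x0 Kx0] L0 fL.
pose S x := [set t : R | exists2 y, K y & t = f y + L * `|x - y|].
have S0 x : S x !=set0 by exists (f x0 + L * `|x - x0|), x0.
have low x y : K y -> f x0 - L * `|x - x0| <= f y + L * `|x - y|.
  move=> Ky; have := fL _ _ Kx0 Ky; rewrite ler_norml => /andP[_ H].
  have : L * `|x0 - y| <= L * (`|x - x0| + `|x - y|).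
    by rewrite ler_wpM2l// (le_trans (ler_distD x _ _))// (distrC x0).
  lra.
have lbS x : has_lbound (S x).
  by exists (f x0 - L * `|x - x0|) => _ [y Ky ->]; exact: low.
have infS x : has_inf (S x) by split.
pose g x := inf (S x).
have gle x y : K y -> g x <= f y + L * `|x - y|.
  by move=> Ky; apply: ge_inf => //; exists y.
have half x y : g x - g y <= L * `|x - y|.
  rewrite lerBlDl -lerBlDr; apply: lb_le_inf => // _ [z Kz ->].
  have := gle x z Kz.
  have : L * `|x - z| <= L * (`|x - y| + `|y - z|) by rewrite ler_wpM2l// ler_distD.
  lra.
exists g.
  move=> x y; rewrite ler_norml half andbT lerNl opprB (le_trans (half _ _))//.
  by rewrite distrC.
move=> x Kx; apply/eqP; rewrite eq_le; apply/andP; split.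
  by have := gle x x Kx; rewrite subrr normr0 mulr0 addr0.
apply: lb_le_inf => // _ [y Ky ->].
by have := fL x y Kx Ky; rewrite ler_norml => /andP[_]; lra.
Qed.

End CompactSets.

Lemma clopen_segment (R : realType) (W : normedModType R) (A : set W) (x y : W) :
  open A -> closed A -> A x -> A y.
Proof.
move=> oA cA Ax; pose g (t : R) := x + t *: (y - x).
have gc : continuous g.
  move=> t; exact: (cvgD (cvg_cst _) (cvgZ cvg_id (cvg_cst _))).
have gT : g @^-1` A = setT.
  have /connected_intervalP cT : is_interval [set: R] by [].
  apply: cT.
  - by exists 0; rewrite /g /= scale0r addr0.
  - by exists (g @^-1` A); rewrite ?setTI//; exact: open_comp.
  - by exists (g @^-1` A); rewrite ?setTI//; exact: closed_comp.
have : (g @^-1` A) 1 by rewrite gT.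
by rewrite /g /= scale1r subrKC.
Qed.

(** * Adding an affine function turns solutions for [shiftH H p] into solutions for [H] *)

Section AffineShift.
Context {R : realType} {n : nat}.
Variables (p x0 : 'rV[R]_n).
Implicit Types (f phi w : 'rV[R]_n -> R) (O : set 'rV[R]_n).

Definition affine x : R := dot p (x - x0).

Lemma affine_differentiable x : differentiable affine x /\ grad affine x = p.
Proof.
apply: (@differentiable_of_remainder _ _ _ _ _ 0) => h _.
by rewrite /affine -(addrA h x) (dotDr h) mul0r addrK subrr normr0.
Qed.

Lemma affine_lip : lip (n%:R * `|p|) affine.
Proof.
move=> x y; rewrite /affine -dotNr -dotDr opprB addrA subrK.
exact: norm_dot_le.
Qed.

Lemma grad_lincomb f phi (s t : R) x : differentiable f x -> differentiable phi x ->
  differentiable (fun z => s * f z + t * phi z) x /\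
  grad (fun z => s * f z + t * phi z) x = s *: grad f x + t *: grad phi x.
Proof.
move=> df dphi.
have d1 : differentiable (s \*: f) x by exact: differentiableZ.
have d2 : differentiable (t \*: phi) x by exact: differentiableZ.
have E : (fun z => s * f z + t * phi z) = (s \*: f) + (t \*: phi) by [].
split; first by rewrite E; exact: differentiableD.
apply/rowP => i; rewrite !mxE E.
rewrite deriveD; [|exact: diff_derivable|exact: diff_derivable].
by rewrite !deriveZ//; exact: diff_derivable.
Qed.

Lemma C1_lincomb O f phi (s t : R) : open O -> C1_on O f -> C1_on O phi ->
  C1_on O (fun z => s * f z + t * phi z).
Proof.
move=> oO [df cf] [dphi cphi]; split=> x Ox.
  by have [] := grad_lincomb s t (df x Ox) (dphi x Ox).
have gx := (grad_lincomb s t (df x Ox) (dphi x Ox)).2.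
rewrite /prop_for /continuous_at gx.
have nE : \forall z \near x, s *: grad f z + t *: grad phi z =
    grad (fun z => s * f z + t * phi z) z.
  near=> z; have Oz : O z by near: z; exact: open_nbhs_nbhs.
  by rewrite (grad_lincomb s t (df z Oz) (dphi z Oz)).2.
apply: cvg_trans (near_eq_cvg nE) _.
exact: (cvgD (cvgZ (cvg_cst _) (cf x Ox)) (cvgZ (cvg_cst _) (cphi x Ox))).
Unshelve. all: by end_near. Qed.

Lemma affine_C1 O : C1_on O affine.
Proof.
have gE : grad affine = cst p by apply/funext => z; have [] := affine_differentiable z.
split=> x _; first by have [] := affine_differentiable x.
by rewrite gE; exact: cst_continuous.
Qed.

Lemma C1_subl O phi : open O -> C1_on O phi ->
  C1_on O (fun z => phi z - affine z) /\
  forall x, O x -> grad (fun z => phi z - affine z) x = grad phi x - p.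
Proof.
move=> oO phiC.
have E : (fun z => phi z - affine z) = fun z => 1 * phi z + (-1) * affine z.
  by apply/funext => z; rewrite mul1r mulN1r.
split; first by rewrite E; exact: C1_lincomb (affine_C1 O).
move=> x Ox; have [da ga] := affine_differentiable x.
by rewrite E (grad_lincomb 1 (-1) (phiC.1 x Ox) da).2 ga scale1r scaleN1r.
Qed.

Lemma visc_subsolution_shift H O (mu : R) w : open O ->
  visc_subsolution O (shiftH H p) mu w ->
  visc_subsolution O H mu (fun x => w x + affine x).
Proof.
move=> oO sub phi x phiC Ox loc.
have [C gE] := C1_subl oO phiC.
have := sub _ x C Ox; rewrite /shiftH gE// subrKC; apply.
by apply: filterS loc => y; lra.
Qed.

Lemma visc_supersolution_shift H O (mu : R) w : open O ->
  visc_supersolution O (shiftH H p) mu w ->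
  visc_supersolution O H mu (fun x => w x + affine x).
Proof.
move=> oO sup phi x phiC Ox loc.
have [C gE] := C1_subl oO phiC.
have := sup _ x C Ox; rewrite /shiftH gE// subrKC; apply.
by apply: filterS loc => y; lra.
Qed.

End AffineShift.

(** * Mollified subsolutions *)

Section Hamiltonian.
Context {R : realType} {n : nat} (E : euclid_measure R n).
Variable H : 'rV[R]_n -> 'rV[R]_n -> R.
Hypothesis n0 : (0 < n)%N.
Hypothesis Hcont : forall x, continuous (H^~ x).
Hypothesis Hconv : forall x t q q', 0 <= t <= 1 ->
  H (t *: q + (1 - t) *: q') x <= t * H q x + (1 - t) * H q' x.
Hypothesis Hcoer : forall b, exists M, forall q x, H q x <= b -> `|q| <= M.
Hypothesis Hunif : forall M e, 0 < e -> exists2 s : R, 0 < s &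
  forall q x y, `|q| <= M -> `|x - y| <= s -> `|H q x - H q y| < e.
Implicit Types (O : set 'rV[R]_n) (D f : 'rV[R]_n -> R).

(** Coercivity bounds the gradients in the sublevel sets uniformly in the point, which brings
    uniform continuity into play. *)
Lemma sublevel_stable b b' : b < b' -> exists2 s : R, 0 < s &
  forall q x y, `|x - y| <= s -> H q x <= b -> H q y <= b'.
Proof.
move=> bb'; have [M HM] := Hcoer b.
have d0 : 0 < b' - b by rewrite subr_gt0.
have [s s0 Hs] := Hunif M d0.
exists s => // q x y xy Hq.
have := Hs q x y (HM _ _ Hq) xy; rewrite ltr_norml => /andP[? ?]; lra.
Qed.

Lemma separation p x b : b < H p x ->
  exists e a, [/\ e != 0, forall q, H q x <= b -> dot e q <= a & a < dot e p].
Proof.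
move=> bp; have [M HM] := Hcoer b.
exact: (sublevel_separation n0 (@Hcont x) (@Hconv x) (fun q => HM q x) bp).
Qed.

Lemma grad_le_of_increments f x e (a T0 : R) : differentiable f x -> 0 < T0 ->
  (forall T, 0 <= T <= T0 -> f (x + T *: e) - f x <= a * T) ->
  dot e (grad f x) <= a.
Proof.
move=> df T00 fa; rewrite dotC -differentiable_grad//.
have cs := derivable_cvg_seq (diff_derivable (v := e) df).
apply: (ler_cvg_to cs (cvg_cst a)).
have [N _ NP] := near_infty_natSinv_lt (PosNum T00).
exists N => // m /= Nm; have mT := NP m Nm; rewrite /= in mT.
have := fa m.+1%:R^-1; rewrite invr_ge0 ler0n (ltW mT) => /(_ isT) H1.
rewrite /cst -ler_pdivlMl// [leRHS]mulrC (addrC (_ *: e)); exact: H1.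
Qed.

(** The half space is chosen at the single point [x] for the level [b']; within distance [s0] it
    contains the sublevel sets of level [b]. Here [f] is a Lipschitz extension of [D] from a
    neighbourhood of [x], and [s0] depends on the levels only. *)
Lemma visc_mollify b b' : b < b' -> exists2 s0 : R, 0 < s0 &
  forall O D f L x s r, continuous D -> visc_subsolution O H b D ->
    0 <= L -> lip L f -> 0 < s -> s <= s0 ->
    (forall z, `|z - x| <= s -> O z /\ f z = D z) -> 0 < r -> 4 * r <= s ->
    H (grad (mollify E r f) x) x <= b'.
Proof.
move=> bb'; have [s0 s00 Hs0] := sublevel_stable bb'.
exists s0 => // O D f L x s r cD subD L0 fL s_gt0 ss0 OfD r0 rs.
rewrite leNgt; apply/negP => /separation[e [a [e0 ea ap]]].
have tr := @visc_transport _ _ O H b D x s e a cD subD s_gt0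
  (fun z zs => (OfD z zs).1) e0 _.
have {}tr := tr (fun z q zs Hq => ea q (Hs0 q z x (le_trans zs ss0) Hq)).
suff : dot e (grad (mollify E r f) x) <= a by rewrite leNgt ap.
have [df _] := mollify_differentiable E r0 L0 fL x.
have en : 0 < `|e| by rewrite normr_gt0.
pose T0 := s / (4 * `|e|); have T00 : 0 < T0 by rewrite divr_gt0// mulr_gt0.
apply: (grad_le_of_increments df T00) => T /andP[T_ge0 TT0].
have Ts : 4 * (T * `|e|) <= s by rewrite mulrCA -ler_pdivlMr// mulr_gt0.
apply: (mollify_increment_le E r0 L0 fL) => y yr.
have yx : 4 * `|y - x| <= s by rewrite (le_trans _ rs)// ler_pM2l.
have := tr y T yx T_ge0 Ts.
have nT : `|T *: e| = T * `|e| by rewrite normrZ ger0_norm.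
rewrite -(OfD y _).2; last lra.
rewrite -(OfD (y + T *: e) _).2//.
rewrite addrAC (le_trans (ler_normD _ _))// nT; lra.
Qed.

(** The counterpart of [visc_mollify] for a gradient bound that holds almost everywhere, as an
    essential supremum provides it. *)
Lemma ae_mollify b b' : b < b' -> exists2 s0 : R, 0 < s0 &
  forall f L x r, 0 <= L -> lip L f -> 0 < r -> r <= s0 ->
    {ae em_mu E, forall w, `|em_X w - x| <= r -> H (grad f (em_X w)) (em_X w) <= b} ->
    H (grad (mollify E r f) x) x <= b'.
Proof.
move=> bb'; have [s0 s00 Hs0] := sublevel_stable bb'.
exists s0 => // f L x r L0 fL r0 rs0 ae_b.
rewrite leNgt; apply/negP => /separation[e [a [e0 ea ap]]].
suff : dot e (grad (mollify E r f) x) <= a by rewrite leNgt ap.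
apply: (mollify_grad_le r0 L0 fL).
apply: filterS ae_b => w Hw wr; apply: ea.
by apply: Hs0 (Hw wr); rewrite (le_trans wr).
Qed.

(** Coercivity bounds the slope in every direction, and the increment estimate in the direction
    [z - y] with [T = 1] turns this into a Lipschitz bound. *)
Lemma visc_lip_near O D b x s : continuous D -> visc_subsolution O H b D ->
  0 < s -> (forall z, `|z - x| <= s -> O z) -> lip_near D x.
Proof.
move=> cD subD s0 OB; have [M HM] := Hcoer b.
exists (s / 8), (n%:R * M); split; first by rewrite divr_gt0.
have half y z : `|y - x| <= s / 8 -> `|z - x| <= s / 8 ->
    D z - D y <= n%:R * M * `|y - z|.
  move=> ys zs; have [->|zy] := eqVneq z y; first by rewrite !subrr normr0 mulr0.
  have e0 : z - y != 0 by rewrite subr_eq0.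
  have yz : `|z - y| <= s / 4.
    have := ler_distD x z y; rewrite (distrC x y); lra.
  have Ha w q : `|w - x| <= s -> H q w <= b -> dot (z - y) q <= n%:R * M * `|z - y|.
    move=> _ /HM qM; rewrite (le_trans (ler_norm _))// (le_trans (norm_dot_le _ _))//.
    by rewrite mulrAC ler_wpM2r// ler_wpM2l.
  have A1 : 4 * `|y - x| <= s by lra.
  have A2 : 4 * (1 * `|z - y|) <= s by lra.
  have := visc_transport cD subD s0 OB e0 Ha A1 ler01 A2.
  by rewrite scale1r subrKC mulr1 (distrC z y).
move=> y z ys zs; rewrite ler_norml; apply/andP; split.
  by rewrite lerNl opprB half.
by rewrite distrC half.
Qed.

End Hamiltonian.

Lemma lip_of_lipschitz (R : realType) (V : normedModType R) (f : V -> R) (A : set V) :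
  [lipschitz f x | x in A] -> exists L : R,
    forall x y, A x -> A y -> `|f x - f y| <= L * `|x - y|.
Proof.
move=> [M [_ fM]]; exists (M + 1) => x y Ax Ay.
by have := fM (M + 1); rewrite ltrDl ltr01 => /(_ isT) /(_ (x, y)); exact.
Qed.

Lemma lipschitz_of_lip (R : realType) (V : normedModType R) (f : V -> R) (A : set V) (L : R) :
  lip L f -> [lipschitz f x | x in A].
Proof.
move=> fL; exists L; split; first by rewrite num_real.
move=> M LM [x y] _ /=; rewrite (le_trans (fL x y))// ler_wpM2r//.
exact: ltW.
Qed.

Lemma locally_lipschitz_near (R : realType) (n : nat) (U : set 'rV[R]_n)
    (f : 'rV[R]_n -> R) x : locally_lipschitz U f -> U x -> lip_near f x.
Proof.
move=> fU /fU[A /nbhs_normP[e /= e0 eA] /lip_of_lipschitz[L fL]].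
exists (e / 2), L; split; first by rewrite divr_gt0.
have e2 z : `|z - x| <= e / 2 -> A z.
  move=> zx; apply: eA => /=; rewrite distrC (le_lt_trans zx)//.
  by rewrite ltr_pdivrMr// ltr_pMr// ltr1n.
by move=> y z /e2 Ay /e2 Az; exact: fL.
Qed.

Lemma bounded_setS (R : realType) (W : normedModType R) (A B : set W) :
  A `<=` B -> bounded_set B -> bounded_set A.
Proof. by move=> AB [M [rM HM]]; exists M; split=> // N MN x /AB; exact: HM. Qed.

(** * The comparison argument *)

Section LevelSets.
Context {R : realType} {n : nat}.
Variables (V : set 'rV[R]_n) (f : 'rV[R]_n -> R) (mb : R).
Hypotheses (oV : open V) (bV : bounded_set (closure V)).
Hypothesis fc : forall x, closure V x -> {for x, continuous f}.
Hypothesis fb : forall x, boundary V x -> f x <= mb.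

Definition superlevel (c : R) := [set x | closure V x /\ c <= f x].

Lemma superlevel_closed c : closed (superlevel c).
Proof.
move=> x clx; have cVx : closure V x.
  have clV : closed (closure V) by exact: closed_closure.
  by rewrite (proj1 (closure_id _) clV); apply: closureS clx => y [].
split=> //; rewrite leNgt; apply/negP => fx.
have nx : nbhs x [set y | f y < c] by exact: (cvgr_lt _ (fc cVx)).
by have [y [[_ cy] /=]] := clx _ nx; rewrite ltNge cy.
Qed.

Lemma superlevel_compact c : compact (superlevel c).
Proof.
apply: bounded_closed_compact; last exact: superlevel_closed.
by apply: bounded_setS bV => y [].
Qed.

Lemma superlevel_sub c : mb < c -> superlevel c `<=` V.
Proof.
move=> mc x [clx cx]; apply: contrapT => nVx.
have : f x <= mb by apply: fb; split=> // /interior_subset.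
by rewrite leNgt (lt_le_trans mc).
Qed.

Lemma strict_superlevel_open c : open (V `&` [set x | c < f x]).
Proof.
rewrite openE => x [Vx cx]; apply: filterI; first exact: open_nbhs_nbhs.
have cVx : closure V x by exact: subset_closure.
exact: (cvgr_gt _ (fc cVx)).
Qed.

End LevelSets.

Section Comparison.
Context {R : realType} {n : nat} (E : euclid_measure R n).
Variable H : 'rV[R]_n -> 'rV[R]_n -> R.
Hypothesis n0 : (0 < n)%N.
Hypothesis Hcont : forall x, continuous (H^~ x).
Hypothesis Hconv : forall x t q q', 0 <= t <= 1 ->
  H (t *: q + (1 - t) *: q') x <= t * H q x + (1 - t) * H q' x.
Hypothesis Hcoer : forall b, exists M, forall q x, H q x <= b -> `|q| <= M.
Hypothesis Hunif : forall M e, 0 < e -> exists2 s : R, 0 < s &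
  forall q x y, `|q| <= M -> `|x - y| <= s -> `|H q x - H q y| < e.

Variables (U V O : set 'rV[R]_n) (u D w : 'rV[R]_n -> R) (mu mu' mb Lw : R).
Hypotheses (usub : absolute_subminimizer H U u).
Hypotheses (bV : bounded_set (closure V)) (oV : open V) (VU : closure V `<=` U).
Hypotheses (cD : continuous D) (oO : open O) (VO : V `<=` O).
Hypotheses (Dsub : visc_subsolution O H mu D) (Dsup : visc_supersolution O H mu D).
Hypotheses (Lw0 : 0 <= Lw) (wL : lip Lw w) (mu'mu : mu' < mu).
Hypothesis wsub : visc_subsolution setT H mu' w.

Local Notation f := (fun x => u x - D x).
Local Notation X := (@em_X _ _ E).

Hypothesis bdry : forall x, boundary V x -> f x <= mb.

Let fc x : closure V x -> {for x, continuous f}.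
Proof.
move=> /VU Ux; have cu : {for x, continuous u}.
  exact: lip_near_continuous (locally_lipschitz_near usub.1 Ux).
have ux : u y @[y --> x] --> u x by exact: cu.
have Dx : D y @[y --> x] --> D x by exact: cD.
have uD := cvgB ux Dx; exact: uD.
Qed.

Let K c := superlevel V f c.
Let W c := V `&` [set x | c < f x].

Let cK c : compact (K c). Proof. exact: superlevel_compact. Qed.
Let KV c : mb < c -> K c `<=` V. Proof. exact: superlevel_sub. Qed.
Let oW c : open (W c). Proof. exact: strict_superlevel_open. Qed.
Let WK c : W c `<=` K c.
Proof. by move=> x [Vx cx]; split; [exact: subset_closure|exact: ltW]. Qed.
Let KW c c' : mb < c -> c < c' -> K c' `<=` W c.
Proof.
move=> mc cc' x [clx cx]; split; last exact: lt_le_trans cx.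
by apply: (KV (lt_trans mc cc')).
Qed.

Lemma D_lip_near x : V x -> lip_near D x.
Proof.
move=> /VO Ox; have /nbhs_normP[e /= e0 eO] : nbhs x O by exact: open_nbhs_nbhs.
apply: (visc_lip_near Hcoer cD Dsub (s := e / 2)); first by rewrite divr_gt0.
move=> z zx; apply: eO => /=; rewrite distrC (le_lt_trans zx)//.
by rewrite ltr_pdivrMr// ltr_pMr// ltr1n.
Qed.

Section Competitor.
Variables (c g : R) (ut Dt : 'rV[R]_n -> R) (Lu LD : R).
Hypotheses (mc : mb < c) (g0 : 0 < g).
Hypotheses (utL : lip Lu ut) (LD0 : 0 <= LD) (DtL : lip LD Dt).
Hypotheses (utE : forall x, K c x -> ut x = u x) (DtE : forall x, K c x -> Dt x = D x).

(* Replacing [D] by a smooth approximation in the definition of the competitor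
   makes its gradient bound hold everywhere. *)
Lemma gradient_bound_ae eta : 0 < eta -> exists N : set 'rV[R]_n,
  [/\ open N, W (c + 4 * g) `<=` N, N `<=` K c &
   {ae em_mu E, forall v, N (X v) -> H (grad ut (X v)) (X v) <= mu + 2 * eta}].
Proof.
move=> eta0.
have mueta : mu < mu + eta by rewrite ltrDl.
have [s0 s00 Hs0] := visc_mollify E n0 Hcont Hconv Hcoer Hunif mueta.
have c1 : c < c + g by rewrite ltrDl.
have mcg : mb < c + g by rewrite (lt_trans mc).
have [s1 s10 Hs1] := compact_open_margin (@cK (c + g)) (@oW c) (@KW c _ mc c1).
pose s := Num.min s0 s1; have s_gt0 : 0 < s by rewrite lt_min s00.
pose r := Num.min (s / 4) (g / (LD + 1)).
have LD1 : 0 < LD + 1 by rewrite ltr_wpDl.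
have r0 : 0 < r by rewrite lt_min !divr_gt0.
have rs : 4 * r <= s by rewrite mulrC -ler_pdivlMr// ge_min lexx.
have rg : LD * r <= g.
  have : r <= g / (LD + 1) by rewrite ge_min lexx orbT.
  rewrite ler_pdivlMr// mulrDr mulr1 mulrC; have := ltW r0; lra.
pose Dr := mollify E r Dt.
have DrL : lip LD Dr := mollify_lip E r0 LD0 DtL.
have Dr_close x : `|Dr x - Dt x| <= g.
  by rewrite (le_trans (mollify_close E r0 LD0 DtL x)).
(* On the boundary of [N] the competitor [Dr + (c + 2 * g)] meets [u]. As [Dr] is within [g] of [D],
   the set [N] lies between the levels [c + g] and [c + 4 * g]. *)
pose N := W c `&` [set x | c + 2 * g < ut x - Dr x].
have cdiff : continuous (fun x => ut x - Dr x).
  move=> x; have h := cvgB (@lip_continuous _ _ _ _ utL x) (@lip_continuous _ _ _ _ DrL x); exact: h.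
have oN : open N.
  apply: openI; first exact: oW.
  apply: (@open_comp _ _ (fun x => ut x - Dr x) [set t | c + 2 * g < t]); last exact: open_gt.
  by move=> x _; exact: cdiff.
have NK x : N x -> K (c + g) x.
  move=> [Wx /= Nx]; have Kx := WK Wx; split; first exact: Kx.1.
  rewrite -(utE Kx) -(DtE Kx).
  by have := Dr_close x; rewrite ler_norml => /andP[? ?]; lra.
have clNK : closure N `<=` K (c + g).
  move=> x; have clK : closed (K (c + g)) by exact: superlevel_closed.
  by rewrite [K (c + g)](proj1 (closure_id _) clK); apply: closureS.
have NN : N `<=` K c by move=> x [/WK].
exists N; split=> //.
  move=> x [Vx /= fx]; have Wx : W c x by split=> //=; lra.
  split=> //=; have Kx := WK Wx; move: fx; rewrite -(utE Kx) -(DtE Kx).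
  by have := Dr_close x; rewrite ler_norml => /andP[? ?]; lra.
pose v x := Dr x + (c + 2 * g).
have gradv x : N x -> H (grad v x) x <= mu + eta.
  move=> Nx; have [dDr _] := mollify_differentiable E r0 LD0 DtL x.
  have -> : grad v x = grad Dr x.
    apply/rowP => i; rewrite !mxE deriveD//; last exact: diff_derivable.
    by rewrite derive_cst addr0.
  apply: (Hs0 O D Dt LD x s r) => //; first by rewrite ge_min lexx.
  move=> z zs; have Wz : W c z.
    by apply: Hs1 (NK _ Nx) _; rewrite (le_trans zs)// ge_min lexx orbT.
  by split; [apply: VO; case: Wz|exact: DtE (WK Wz)].
have ess_le : (ess_sup_on N (fun x => (H (grad u x) x)%:E) <= (mu + eta)%:E)%E.
  apply: le_trans (usub.2 N v _ _ _ _) _.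
  - by split=> // x /clNK/(KV mcg)/subset_closure/VU.
  - apply: (@lipschitz_of_lip _ _ _ _ LD) => x y.
    by rewrite /v opprD addrACA subrr addr0.
  - by move=> x Nx; rewrite /v -(utE (NN _ Nx)); case: Nx => _ /=; lra.
  (* A boundary point of [N] is interior to [W c], since it lies in [K (c + g)]; what keeps it out
     of [N] is therefore the strict inequality, which becomes an equality there. *)
  - move=> x [clx ninx]; have Wx : W c x by exact: KW c1 _ (clNK _ clx).
    have Nx : ~ N x by move=> Nx; apply: ninx; exact: open_nbhs_nbhs.
    apply/eqP; rewrite eq_le /v -(utE (WK Wx)); apply/andP; split.
      pose S := [set x | c + 2 * g <= ut x - Dr x].
      have clS : closed S.
        apply: (@closed_comp _ _ (fun x => ut x - Dr x) [set t | c + 2 * g <= t]); last exact: closed_ge.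
        by move=> y _; exact: cdiff.
      have : closure S x by apply: closureS clx => y [_ /= /ltW].
      by rewrite -(proj1 (closure_id _) clS) /S /=; lra.
    by rewrite leNgt; apply/negP => lt; apply: Nx; split=> //=; lra.
  - by apply: ess_sup_on_le => // x Nx; rewrite lee_fin gradv.
(* The essential supremum is an infimum over bounds, so passing to a null set takes a strict
   inequality: hence the second [eta]. *)
have ess_lt : (ess_sup_on N (fun x => (H (grad u x) x)%:E) < (mu + 2 * eta)%:E)%E.
  by apply: le_lt_trans ess_le _; rewrite lte_fin; lra.
apply: negligibleS (ess_sup_on_negligible E ess_lt) => y /= nH.
have [NX|nNX] := pselect (N (X y)); last by exfalso; apply: nH.
split=> //; rewrite lee_fin => Hu; apply: nH => _.
rewrite (_ : grad ut (X y) = grad u (X y))//.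
apply/rowP => i; rewrite !mxE; apply: near_eq_derive.
apply: filterS (open_nbhs_nbhs (conj oN NX)) => z /NN; exact: utE.
Qed.

End Competitor.

Lemma comparison_interior xm : closure V xm -> f xm <= mb.
Proof.
move=> clxm; rewrite leNgt; apply/negP => mbx.
(* Counted from [mb] in units of [g]: [K c] starts at level 1, the gradient bound for [u] holds
   above 5, the maximum point of [th - D] lies above 7, and [xm] is at 8. The step from 6 to 5 makes
   room for the mollification radius. *)
pose g : R := (f xm - mb) / 8; have g0 : 0 < g by rewrite divr_gt0// subr_gt0.
have fxm : f xm = mb + 8 * g by rewrite /g; lra.
pose c := mb + g; have mc : mb < c by rewrite ltrDl.
have Kxm : K c xm by split=> //; rewrite fxm /c; lra.
have KcV : K c `<=` V by exact: KV.
have K0 : K c !=set0 by exists xm.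
have u_near x : K c x -> lip_near u x.
  by move=> /KcV Vx; exact: locally_lipschitz_near usub.1 (VU (subset_closure Vx)).
have D_near x : K c x -> lip_near D x by move=> /KcV /D_lip_near.
have [Lu Lu0 uLip] := compact_lip (@cK c) u_near.
have [LD LD0 DLip] := compact_lip (@cK c) D_near.
have [ut utL utE] := mcshane K0 Lu0 uLip.
have [Dt DtL DtE] := mcshane K0 LD0 DLip.
have [S S0 Sb] : exists2 S : R, 0 <= S & forall x, K c x -> `|w x| + `|ut x| <= S.
  have [B [rB HB]] := bV; pose B1 := `|B| + 1.
  have [S1 S10 Hw] := continuous_bounded_ball 0 B1 (@lip_continuous _ _ _ _ wL).
  have [S2 S20 Hu] := continuous_bounded_ball 0 B1 (@lip_continuous _ _ _ _ utL).
  exists (S1 + S2); first exact: addr_ge0.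
  move=> x [clx _]; have xB : `|x - 0| <= B1.
    by rewrite subr0; apply: HB => //; rewrite /B1 ltr_pwDr// ler_norm.
  by rewrite lerD ?Hw ?Hu.
(* The weight of the strict subsolution: its gain [t * (mu - mu')] has to exceed
   the errors, which are multiples of [eta], while [t * (w - u)] stays below [g]. *)
pose t : R := Num.min (1 / 2) (g / (4 * (S + 1))).
have S1 : 0 < S + 1 by rewrite ltr_wpDl.
have tpos : 0 < 4 * (S + 1) by rewrite mulr_gt0.
have t0 : 0 < t by rewrite lt_min; apply/andP; split; exact: divr_gt0.
have t12 : t <= 1 / 2 by rewrite ge_min lexx.
have tS : 4 * (t * S) <= g.
  have : t <= g / (4 * (S + 1)) by rewrite ge_min lexx orbT.
  rewrite ler_pdivlMr// => h; apply: le_trans h.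
  rewrite mulrCA; apply: ler_wpM2l; lra.
pose eta : R := t * (mu - mu') / 8.
have eta0 : 0 < eta by rewrite divr_gt0// mulr_gt0// subr_gt0.
have [N [oN WN NK Nae]] := gradient_bound_ae mc g0 utL LD0 DtL utE DtE eta0.
have le1 : mu + 2 * eta < mu + 3 * eta by rewrite ltrD2l ltr_pM2r// ltr_nat.
have le2 : mu' < mu' + eta by rewrite ltrDl.
have [s1 s10 Hs1] := ae_mollify E n0 Hcont Hconv Hcoer Hunif le1.
have [s2 s20 Hs2] := visc_mollify E n0 Hcont Hconv Hcoer Hunif le2.
have m5 : mb < mb + 5 * g by rewrite ltrDl mulr_gt0.
have m56 : mb + 5 * g < mb + 6 * g by rewrite ltrD2l ltr_pM2r// ltr_nat.
have [s3 s30 Hs3] := compact_open_margin (@cK (mb + 6 * g)) (@oW (mb + 5 * g)) (KW m5 m56).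
(* [Q * s] dominates the two mollification errors and uses up [g / 4]; [t * S] uses up as much
   again, whence the [g / 2] in [th_close]. *)
pose Q : R := 2 * Lu + Lw + 1; have Q0 : 0 < Q by rewrite ltr_wpDl// addr_ge0// mulr_ge0.
pose s : R := Num.min (Num.min s1 (s2 / 4)) (Num.min s3 (g / (4 * Q))).
have Q40 : 0 < 4 * Q by rewrite mulr_gt0.
have s0 : 0 < s by rewrite !lt_min s10 s30 (divr_gt0 s20)// (divr_gt0 g0).
have ss1 : s <= s1 by rewrite !ge_min lexx.
have ss2 : 4 * s <= s2 by rewrite mulrC -ler_pdivlMr// !ge_min lexx orbT.
have ss3 : s <= s3 by rewrite !ge_min lexx !orbT.
have sQ : 4 * (Q * s) <= g.
  have : s <= g / (4 * Q) by rewrite !ge_min lexx !orbT.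
  by rewrite ler_pdivlMr// mulrC mulrA.
pose us := mollify E s ut; pose ws := mollify E s w.
pose th x := t * ws x + (1 - t) * us x.
have th_close x : K c x -> `|th x - ut x| <= g / 2.
  move=> Kx; have uc := mollify_close E s0 Lu0 utL x.
  have wc := mollify_close E s0 Lw0 wL x.
  have -> : th x - ut x = t * ((ws x - w x) + (w x - ut x)) + (1 - t) * (us x - ut x).
    by rewrite /th; ring.
  have wu : `|w x - ut x| <= S by rewrite (le_trans (ler_normB _ _))// Sb.
  have b1 : `|t * (ws x - w x + (w x - ut x))| <= t * (Lw * s + S).
    rewrite normrM (ger0_norm (ltW t0)); apply: ler_wpM2l; first exact: ltW.
    by rewrite (le_trans (ler_normD _ _))// lerD.
  have b2 : `|(1 - t) * (us x - ut x)| <= 1 * (Lu * s).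
    rewrite normrM; apply: ler_pM => //; rewrite ler_norml; apply/andP; split; lra.
  rewrite (le_trans (ler_normD _ _))// (le_trans (lerD b1 b2))//.
  have tL : t * (Lw * s) <= Lw * s.
    by rewrite -[leRHS]mul1r ler_wpM2r ?mulr_ge0 ?(ltW s0)//; lra.
  have Lus : 0 <= Lu * s by rewrite mulr_ge0// ltW.
  move: sQ; rewrite /Q 2!mulrDl mul1r mulrDr; lra.
have C1th : C1_on O th.
  exact: C1_lincomb t (1 - t) oO (mollify_C1 E s0 Lw0 wL O) (mollify_C1 E s0 Lu0 utL O).
have [x1 Kx1 x1max] : exists2 x1, K c x1 &
    forall x, K c x -> th x - D x <= th x1 - D x1.
  have cth : continuous (fun x => th x - D x).
    move=> x; have usL : lip Lu us := mollify_lip E s0 Lu0 utL.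
    have wsL : lip Lw ws := mollify_lip E s0 Lw0 wL.
    have h1 : us y @[y --> x] --> us x by exact: (@lip_continuous _ _ _ _ usL x).
    have h2 : ws y @[y --> x] --> ws x by exact: (@lip_continuous _ _ _ _ wsL x).
    have h3 : D y @[y --> x] --> D x by exact: cD.
    have h := cvgB (cvgD (cvgM (cvg_cst t) h2) (cvgM (cvg_cst (1 - t)) h1)) h3.
    exact: h.
  have [x1 Kx1 x1m] := EVT_max_rV K0 (@cK c) (continuous_subspaceT cth).
  by exists x1; [rewrite -inE|move=> x Kx; apply: x1m; rewrite inE].
(* Replacing [u] by [th] at [xm] and back at [x1] costs [g / 2] each time; hence [x1] is interior to
   [K c]. *)
have fx1 : mb + 7 * g <= f x1.
  have := x1max _ Kxm; have := th_close _ Kxm; have := th_close _ Kx1.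
  rewrite (utE _ Kxm) (utE _ Kx1) !ler_norml => /andP[? ?] /andP[? ?].
  by move: fxm => /=; lra.
have K6 : K (mb + 6 * g) x1 by split; [exact: Kx1.1|lra].
have Wx1 : W c x1 by split; [exact: KcV|rewrite /= /c; lra].
have Ox1 : O x1 by exact: VO Wx1.1.
have [dw _] := mollify_differentiable E s0 Lw0 wL x1.
have [du _] := mollify_differentiable E s0 Lu0 utL x1.
have Hth : mu <= H (grad th x1) x1.
  apply: (Dsup C1th Ox1).
  have nW : nbhs x1 (W c) by apply: open_nbhs_nbhs; split; [exact: (@oW c)|exact: Wx1].
  apply: filterS nW => z /WK /x1max; lra.
(* The ball of radius [s] around [x1] stays above the level [mb + 5 * g], which is [c + 4 * g],
   hence inside [N]. *)
have Hus : H (grad us x1) x1 <= mu + 3 * eta.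
  apply: (Hs1 ut Lu x1 s) => //; apply: filterS Nae => v Nv vs; apply: Nv.
  by apply: WN; rewrite (_ : c + 4 * g = mb + 5 * g); [apply: Hs3 K6 _; exact: le_trans ss3|rewrite /c; lra].
have Hws : H (grad ws x1) x1 <= mu' + eta.
  apply: (Hs2 setT w w Lw x1 (4 * s) s) => //; first exact: (@lip_continuous _ _ _ _ wL).
  by rewrite mulr_gt0.
move: Hth; rewrite (grad_lincomb t (1 - t) dw du).2 leNgt => /negP; apply.
have t01 : 0 <= t <= 1 by rewrite (ltW t0); lra.
apply: le_lt_trans (Hconv x1 _ _ t01) _.
have p1 : t * H (grad ws x1) x1 <= t * (mu' + eta) by rewrite ler_wpM2l// ltW.
have p2 : (1 - t) * H (grad us x1) x1 <= (1 - t) * (mu + 3 * eta) by rewrite ler_wpM2l//; lra.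
apply: le_lt_trans (lerD p1 p2) _.
(* The bound reached is [mu - t * (mu - mu') + 3 * eta - 2 * t * eta], that is,
   [mu - 5 * eta - 2 * t * eta]. *)
have teta : 0 < t * eta by rewrite mulr_gt0.
have : t * (mu - mu') = 8 * eta by rewrite /eta; lra.
nra.
Qed.

End Comparison.

Lemma continuous_left_section (X Y Z : topologicalType) (f : X -> Y -> Z) (y : Y) :
  continuous (fun z : X * Y => f z.1 z.2) -> continuous (f^~ y).
Proof.
move=> cf x; have c1 : {for x, continuous (fun z : X => (z, y))}.
  move=> A [[B C] [/= Bx Cy] BC]; apply: filterS Bx => z Bz.
  by apply: BC; split=> //=; exact: nbhs_singleton.
exact: (@continuous_comp _ _ _ (fun z : X => (z, y)) (fun z => f z.1 z.2) x c1 (cf _)).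
Qed.

(** * Consequences of the structural assumptions on H, and nonempty boundaries *)

Section Structure.
Context {R : realType} {n : nat}.
Variable H : 'rV[R]_n -> 'rV[R]_n -> R.
Implicit Types (O U V : set 'rV[R]_n).

Lemma convex_function_le (f : 'rV[R]_n -> R) t q q' :
  @convex_function R 'rV[R]_n setT f -> 0 <= t <= 1 ->
  f (t *: q + (1 - t) *: q') <= t * f q + (1 - t) * f q'.
Proof.
move=> cf /andP[t0 t1].
by have := cf (Itv01 t0 t1) q q' (in_setT _) (in_setT _).
Qed.

Lemma coercive_sublevel :
  ereal_inf [set (H p y)%:E | y in [set: 'rV[R]_n]] @[p --> infty_nbhs] --> +oo%E ->
  forall b, exists M, forall q x, H q x <= b -> `|q| <= M.
Proof.
move=> /cvgeyPgt /[swap] b /(_ b)[M HM]; exists M => q x Hq.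
rewrite (le_trans (norm_le_enorm q))// leNgt; apply/negP => /HM.
apply/negP; rewrite -leNgt (le_trans (ereal_inf_lbound _) (_ : (H q x)%:E <= _)%E)//.
Qed.

Lemma unif_continuous_sup_norm :
  (forall r : R, 0 < r -> forall e : R, 0 < e -> exists2 delta : R, 0 < delta &
     forall p q y z : 'rV[R]_n, enorm p < r -> enorm q < r ->
       enorm (p - q) < delta -> enorm (y - z) < delta -> `|H p y - H q z| < e) ->
  forall M e, 0 < e -> exists2 s : R, 0 < s &
  forall q x y, `|q| <= M -> `|x - y| <= s -> `|H q x - H q y| < e.
Proof.
move=> Hunif M e e0; have n1 : 0 < n%:R + 1 :> R by rewrite ltr_wpDl.
have r0 : 0 < n%:R * `|M| + 1 by rewrite ltr_wpDl// mulr_ge0.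
have [d d0 Hd] := Hunif _ r0 e e0.
exists (d / (n%:R + 1)); first exact: divr_gt0.
move=> q x y qM xy.
have en0 : enorm (0 : 'rV[R]_n) <= 0.
  by rewrite (le_trans (enorm_le_norm _))// normr0 mulr0.
have qr : enorm q < n%:R * `|M| + 1.
  rewrite (le_lt_trans (enorm_le_norm _))// (@le_lt_trans _ _ (n%:R * `|M|)) ?ltrDl//.
  by rewrite ler_wpM2l// (le_trans qM)// ler_norm.
apply: Hd => //; first by rewrite subrr (le_lt_trans en0).
rewrite (le_lt_trans (enorm_le_norm _))//.
move: xy; rewrite ler_pdivlMr// mulrDr mulr1 (mulrC _ n%:R) => xy.
have [->|xy0] := eqVneq x y; first by rewrite subrr normr0 mulr0.
by rewrite (lt_le_trans _ xy)// ltrDl normr_gt0 subr_eq0.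
Qed.

(** Short steps against the gradient cannot decrease [phi]. This is what makes constants viscosity
    subsolutions. *)
Lemma grad_local_min O phi x : C1_on O phi -> O x ->
  (\forall y \near x, phi x <= phi y) -> grad phi x = 0.
Proof.
move=> [dphi _] Ox /nbhs_normP[s /= s0 xmin]; have dx := dphi x Ox.
apply/eqP; rewrite -dot_eq0; pose e := - grad phi x.
have gN : grad (- phi) x = e.
  by apply/rowP => i; rewrite !mxE deriveN//; exact: diff_derivable.
have e1 : 0 < 2 * (`|e| + 1) by rewrite mulr_gt0// ltr_wpDl.
have T00 : 0 < s / (2 * (`|e| + 1)) by rewrite divr_gt0.
have dN : differentiable (- phi) x by exact: differentiableN.
have : dot e (grad (- phi) x) <= 0.
  apply: (grad_le_of_increments dN T00) => T /andP[T_ge0 TT].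
  rewrite mul0r subr_le0 lerN2; apply: xmin => /=.
  rewrite opprD addNKr normrN normrZ ger0_norm//.
  move: TT; rewrite ler_pdivlMr//; nra.
rewrite gN /e dotNl dotC dotNl opprK => le0.
by rewrite eq_le le0 dot_ge0.
Qed.

(* Since [inf set0 = 0], the bound on [Hbar] yields a subsolution only because
   the constants show the set in its definition to be nonempty. *)
Lemma Hbar_lt_subsolution p mu :
  (forall r : R, 0 < r ->
     exists C : R, forall q y : 'rV[R]_n, enorm q < r -> `|H q y| <= C) ->
  Hbar H p < mu -> exists2 mu', mu' < mu & exists L w,
    [/\ 0 <= L, lip L w & visc_subsolution setT (shiftH H p) mu' w].
Proof.
move=> Hbd Hp.
have [|mu' [w [/lip_of_lipschitz[L wL] _ sub]] lt] := inf_lt _ Hp.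
  have r0 : 0 < enorm p + 1 by rewrite ltr_wpDl// enorm_ge0.
  have [C HC] := Hbd _ r0; exists C, (fun=> 0); split.
  - by apply: (@lipschitz_of_lip _ _ _ _ 0) => x y; rewrite subrr normr0 mul0r.
  - under eq_fun do rewrite mulr0.
    exact: cvg_cst.
  - move=> phi x phiC _ loc.
    rewrite /shiftH (grad_local_min phiC)//; last first.
      by apply: filterS loc => y; rewrite !sub0r lerN2.
    by rewrite addr0 (le_trans (ler_norm _))// HC// ltrDl.
exists mu' => //; exists `|L|, w; split=> // x y.
by rewrite (le_trans (wL x y I I))// ler_wpM2r// ler_norm.
Qed.

Lemma boundary_closed V : closed (boundary V).
Proof.
rewrite /boundary setDE.
exact: (@closedI _ _ _ (@closed_closure _ V) (open_closedC (@open_interior _ V))).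
Qed.

(** With an empty boundary [V] would be open and closed, and would contain the segment from one of
    its points to [x]. *)
Lemma boundary_neq0 V x : open V -> V !=set0 -> ~ V x -> boundary V !=set0.
Proof.
move=> oV [y Vy] nVx; apply: contrapT => /nonemptyPn b0; apply: nVx.
apply: (@clopen_segment _ _ V y) => // z clz; apply: contrapT => nVz.
have : boundary V z by split=> // /interior_subset.
by rewrite b0.
Qed.

End Structure.

Theorem proposition3p6 (R : realType) (n : nat)
  (H : 'rV[R]_n -> 'rV[R]_n -> R)
  (Hcont : continuous (fun z : 'rV[R]_n * 'rV[R]_n => H z.1 z.2))
  (Hconvex : forall y : 'rV[R]_n,
     @convex_function R 'rV[R]_n setT (fun p => H p y))
  (Hcoercive : ereal_inf [set (H p y)%:E | y in [set: 'rV[R]_n]]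
     @[p --> infty_nbhs] --> +oo%E)
  (Hunif : forall r : R, 0 < r -> forall e : R, 0 < e ->
     exists2 delta : R, 0 < delta &
       forall p q y z : 'rV[R]_n, enorm p < r -> enorm q < r ->
         enorm (p - q) < delta -> enorm (y - z) < delta ->
         `|H p y - H q z| < e)
  (Hbounded : forall r : R, 0 < r ->
     exists C : R, forall p y : 'rV[R]_n, enorm p < r -> `|H p y| <= C)
  (U : set 'rV[R]_n) (Uopen : open U) (Ubounded : bounded_set U)
  (u : 'rV[R]_n -> R) (uusc : usc_on U u)
  (ubounded : [bounded u x | x in U])
  (usub : absolute_subminimizer H U u) :
  comparisons_from_above H U u.
Proof.
move=> ps mu V x0 d _ psmu [oV VU] V0 nVx0 [cd [dsub dsup] _ _] f.
(* In dimension 0 the only point would be both in [V] and equal to [x0]. *)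
have n0 : (0 < n)%N.
  rewrite lt0n; apply/negP => /eqP n0; case: V0 => xv Vxv; apply: nVx0.
  suff -> : x0 = xv by [].
  by apply/rowP => i; have := ltn_ord i; rewrite {2}n0.
have [E] := euclid_measure_exists R n.
have bV : bounded_set (closure V) by exact: bounded_setS VU Ubounded.
pose D x := d x + affine ps x0 x.
have afc : continuous (affine ps x0) by exact: (lip_continuous (affine_lip ps x0)).
have cD : continuous D by move=> x; exact: (cvgD (cd x) (afc x)).
have fc x : closure V x -> {for x, continuous f}.
  move=> /VU Ux; have cu : {for x, continuous u}.
    exact: lip_near_continuous (locally_lipschitz_near usub.1 Ux).
  have ux : u y @[y --> x] --> u x by exact: cu.
  have Dx : D y @[y --> x] --> D x by exact: cD.
  have uD := cvgB ux Dx; exact: uD.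
have max_exists A : closed A -> A `<=` closure V -> A !=set0 ->
    exists2 x, A x & forall y, A y -> f y <= f x.
  move=> cA AV A0.
  have kA : compact A by apply: bounded_closed_compact => //; exact: bounded_setS bV.
  have fA : {within A, continuous f}.
    by apply: continuous_in_subspaceT => x; rewrite inE => /AV; exact: fc.
  have [x Ax xm] := EVT_max_rV A0 kA fA.
  by exists x; [rewrite -inE|move=> y Ay; apply: xm; rewrite inE].
have [xb bxb xbm] := max_exists _ (@boundary_closed _ _ V)
  (@subDsetl _ _ _) (boundary_neq0 oV V0 nVx0).
have clV0 : closure V !=set0 by case: V0 => x /subset_closure; exists x.
have [xm clxm xmm] := max_exists _ (@closed_closure _ V) (fun _ => id) clV0.
have oO : open (~` [set x0] : set 'rV[R]_n).
  by apply: closed_openC; apply: accessible_closed_set1; apply: hausdorff_accessible; exact: norm_hausdorff.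
(* [D] solves the equation away from its vertex only; as [x0] is outside [V], this covers all of
   [V]. *)
have VO : V `<=` ~` [set x0] by move=> x Vx xx0; apply: nVx0; rewrite -xx0.
have [mu' mu'mu [L [w [L0 wL wsub]]]] := Hbar_lt_subsolution Hbounded psmu.
(* The strict subsolution receives the same affine part as [d], so that both refer to [H] itself. *)
pose w' x := w x + affine ps x0 x.
have w'L : lip (L + n%:R * `|ps|) w'.
  move=> x y; rewrite /w' opprD addrACA (le_trans (ler_normD _ _))// mulrDl.
  by rewrite lerD// affine_lip.
have L'0 : 0 <= L + n%:R * `|ps| by rewrite addr_ge0// mulr_ge0.
have Hcont1 x : continuous (H^~ x) by exact: continuous_left_section.
have fxm : f xm <= f xb.
  exact: (comparison_interior E n0 Hcont1
    (fun x t q q' => convex_function_le q q' (Hconvex x))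
    (coercive_sublevel Hcoercive) (unif_continuous_sup_norm Hunif)
    usub bV oV VU cD oO VO (visc_subsolution_shift oO dsub)
    (visc_supersolution_shift oO dsup) L'0 w'L mu'mu
    (visc_subsolution_shift openT wsub) xbm clxm).
exists (f xm); split; split=> //; first by exists xm.
  exists xb => //; apply/eqP; rewrite eq_le fxm andbT.
  by apply: xmm; case: bxb.
by move=> x bx; apply: xmm; case: bx.
Qed.
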